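(* Let $X$ be a complex Banach space, $\tau>0$, let $A_{0}:\mathcal{D}(A_{0})\subseteq X\to X$ be the infinitesimal generator of a strongly continuous semigroup $\{\mathcal{T}(t)\}_{t\ge 0}$ of bounded linear operators, $A_{1}\in\mathcal{L}(X)$, and let the initial function $\varphi\in C([-\tau,0],X)$ satisfy $\varphi(0)\in\mathcal{D}(A_{0})$. Then the classical (strong) solution $u_{0}\in C([-\tau,\infty),X)\cap C^{1}([0,\infty),X)$ of the abstract Cauchy problem $$\frac{\mathrm{d}}{\mathrm{d}t}u(t)=A_{0}u(t)+A_{1}u(t-\tau),\ t\ge 0,\qquad u(t)=\varphi(t),\ -\tau\le t\le 0,$$ satisfies $u_{0}(t)\in\mathcal{D}(A_{0})$ for all $t\ge 0$ and can be represented in the integral form $$u_{0}(t)=\mathcal{S}(t;\tau)\varphi(0)+\int_{-\tau}^{0}\mathcal{S}(t-\tau-s;\tau)A_{1}\varphi(s)\,\mathrm{d}s,\quad t\ge 0,$$ where $\mathcal{S}(\cdot;\tau)$ is the fundamental solution of the equation.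
   Context: A classical (strong) solution of the Cauchy problem is a function $u:[-\tau,\infty)\to X$ that is continuous on $[-\tau,\infty)$, continuously differentiable on $[0,\infty)$, with $u(t)\in\mathcal{D}(A_{0})$ for all $t\ge 0$ (where $\varphi(0)\in\mathcal{D}(A_0)$), satisfying the problem for all $t\ge 0$. The fundamental solution $\mathcal{S}(\cdot;\tau)$ with values in $\mathcal{L}(X)$ is the operator family satisfying $\frac{\mathrm{d}}{\mathrm{d}t}\mathcal{S}(t;\tau)=A_{0}\mathcal{S}(t;\tau)+A_{1}\mathcal{S}(t-\tau;\tau)$ for $t\ge 0$, with $\mathcal{S}(t;\tau)=\Theta$ (zero operator) for $t<0$ and $\mathcal{S}(0;\tau)=I$; it is given explicitly by $\mathcal{S}(t;\tau)=\sum_{n\ge 0}S_{n}(t,n\tau)\mathbf{1}_{t\ge n\tau}$ for $t\ge 0$, where $\mathbf{1}_{t\ge n\tau}$ is $1$ if $t\ge n\tau$ and $0$ otherwise, $S_{0}(t,0)=\mathcal{T}(t)$ and $S_{n}(t,n\tau)=\int_{n\tau}^{t}\mathcal{T}(t-s)A_{1}S_{n-1}(s-\tau,(n-1)\tau)\,\mathrm{d}s$ for $t\ge n\tau$, $n\in\mathbb{N}$ (integrals in the strong operator topology). *)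

(* Defs.v *)
From Stdlib Require Import Reals Lra.
From Coquelicot Require Import Coquelicot.
Open Scope R_scope.

(** Restriction of scalars from [C] to [R].  [RInt] and derivatives along the
    real line are only available for normed modules over [R_AbsRing].  The
    carrier, addition, uniform structure, norm and completeness structure of
    [realify X] are those of [X], so elements of [X] and of [realify X] are
    convertible. *)
Section Realify.

Variable X : CompleteNormedModule C_AbsRing.

Definition realify_scal (a : R) (x : X) : X := scal (RtoC a) x.

Lemma realify_scal_assoc (a b : R) (x : X) :
  realify_scal a (realify_scal b x) = realify_scal (mult a b) x.
Proof.
  unfold realify_scal; rewrite scal_assoc; f_equal.
  symmetry; exact (RtoC_mult a b).
Qed.

Lemma realify_scal_one (x : X) : realify_scal one x = x.
Proof. exact (scal_one x). Qed.

Lemma realify_scal_distr_l (a : R) (x y : X) :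
  realify_scal a (plus x y) = plus (realify_scal a x) (realify_scal a y).
Proof. exact (scal_distr_l (RtoC a) x y). Qed.

Lemma realify_scal_distr_r (a b : R) (x : X) :
  realify_scal (plus a b) x = plus (realify_scal a x) (realify_scal b x).
Proof.
  unfold realify_scal.
  refine (eq_trans _ (scal_distr_r (RtoC a) (RtoC b) x)); f_equal.
  exact (RtoC_plus a b).
Qed.

Definition realify_ModuleSpace_mixin :=
  ModuleSpace.Mixin R_Ring X realify_scal realify_scal_assoc realify_scal_one
    realify_scal_distr_l realify_scal_distr_r.

Definition realify_NormedModuleAux : NormedModuleAux R_AbsRing :=
  NormedModuleAux.Pack R_AbsRing X
    (NormedModuleAux.Class R_AbsRing X
       (ModuleSpace.Class R_Ring X (AbelianGroup.class X)
          realify_ModuleSpace_mixin)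
       (UniformSpace.class X))
    X.

Lemma realify_norm_scal (a : R) (x : X) :
  norm (realify_scal a x) <= abs a * norm x.
Proof.
  apply Rle_trans with (1 := norm_scal (RtoC a) x).
  apply Req_le; f_equal; exact (Cmod_R a).
Qed.

Definition realify_NormedModule_mixin :
    NormedModule.mixin_of R_AbsRing realify_NormedModuleAux :=
  NormedModule.Mixin R_AbsRing realify_NormedModuleAux
    (@norm C_AbsRing X) (@norm_factor C_AbsRing X)
    norm_triangle realify_norm_scal norm_compat1 norm_compat2 norm_eq_zero.

Definition realify : CompleteNormedModule R_AbsRing :=
  CompleteNormedModule.Pack R_AbsRing X
    (CompleteNormedModule.Class R_AbsRing X
       (NormedModule.Class R_AbsRing X
          (NormedModuleAux.class R_AbsRing realify_NormedModuleAux)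
          realify_NormedModule_mixin)
       (CompleteNormedModule.mixin C_AbsRing X
          (CompleteNormedModule.class C_AbsRing X)))
    X.

End Realify.

(** Elements of L(X) are functions [B : X -> X] with [is_linear B]; Coquelicot's
    [is_linear] includes boundedness, and is [C]-linearity here. *)

(** Only the values [T t] with [0 <= t] are meaningful. *)
Record C0_semigroup {X : CompleteNormedModule C_AbsRing} (T : R -> X -> X)
    : Prop := {
  C0_bounded : forall t, 0 <= t -> is_linear (T t);
  C0_zero : forall x, T 0 x = x;
  C0_add : forall s t, 0 <= s -> 0 <= t -> forall x, T (s + t) x = T s (T t x);
  C0_strong : forall x, filterlim (fun t => T t x) (at_right 0) (locally x)
}.

Definition is_generator_at {X : CompleteNormedModule C_AbsRing}
    (T : R -> X -> X) (x y : X) : Prop :=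
  filterlim (fun h : R => scal (RtoC (/ h)) (minus (T h x) x))
    (at_right 0) (locally y).

(** The unbounded operator A0 is a pair of a domain [D] and a function whose
    values outside [D] are irrelevant. *)
Definition is_generator {X : CompleteNormedModule C_AbsRing}
    (T : R -> X -> X) (D : X -> Prop) (A0 : X -> X) : Prop :=
  (forall x, D x <-> exists y, is_generator_at T x y) /\
  (forall x, D x -> is_generator_at T x (A0 x)).

(** Derivative at [t] of a function on [0, +oo): two-sided for [t > 0],
    right-hand at [t = 0]. *)
Definition is_derive_half {X : CompleteNormedModule C_AbsRing}
    (u : R -> X) (t : R) (l : X) : Prop :=
  @filterdiff R_AbsRing R_NormedModule (realify X) u
    (within (fun s => 0 <= s) (locally t))
    (fun h : R => @scal R_AbsRing (realify X) h l).

Record classical_solution {X : CompleteNormedModule C_AbsRing} (tau : R)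
    (D : X -> Prop) (A0 A1 : X -> X) (phi u : R -> X) : Prop := {
  sol_cont : continuous_on (fun t => - tau <= t) u;
  sol_C1 : exists du : R -> X,
    continuous_on (fun t => 0 <= t) du /\
    forall t, 0 <= t -> is_derive_half u t (du t);
  sol_dom : forall t, 0 <= t -> D (u t);
  sol_eq : forall t, 0 <= t ->
    is_derive_half u t (plus (A0 (u t)) (A1 (u (t - tau))));
  sol_init : forall t, - tau <= t <= 0 -> u t = phi t
}.

(** [fund_term tau T A1 n t x] is S_n(t, n tau) x, meaningful for
    [n tau <= t]. *)
Fixpoint fund_term {X : CompleteNormedModule C_AbsRing} (tau : R)
    (T : R -> X -> X) (A1 : X -> X) (n : nat) (t : R) (x : X) : X :=
  match n with
  | O => T t x
  | S m =>
      @RInt (realify X)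
        (fun s => T (t - s) (A1 (fund_term tau T A1 m (s - tau) x)))
        (INR n * tau) t
  end.

(** The fundamental solution S(t; tau) x.  [iota] picks the unique sum of the
    series, in the same way as it defines [RInt]. *)
Definition fund_sol {X : CompleteNormedModule C_AbsRing} (tau : R)
    (T : R -> X -> X) (A1 : X -> X) (t : R) (x : X) : X :=
  if Rlt_dec t 0 then zero
  else iota (is_series (fun n : nat =>
         if Rle_dec (INR n * tau) t then fund_term tau T A1 n t x else zero)).

(* Main.v *)
Require Import Defs.
From Stdlib Require Import Reals Lra Lia List Classical ClassicalEpsilon.
From Coquelicot Require Import Coquelicot.
Open Scope R_scope.

(** Write [S] for the fundamental solution and [w q = S(q) A1 u(t - tau - q)].
    On the domain of the generator, [S] has the right derivative
    [S(q) A0 + S(q - tau) A1], with the operators in the reverse of the order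
    in the defining equation.  For a classical solution [u], the terms with
    [A0] in the derivative of [q |-> S(q) u(t - q)] therefore cancel, and what
    remains is [w (q - tau) - w q].  This is also the derivative of minus the
    integral of [w] over [q - tau, q], so the sum of the two functions is
    constant on [0, t]; its values at the end points [0] and [t] are the two
    sides of the representation formula.

    The reversed derivative is proved term by term: the right derivative of a
    convolution [int_0^t T(t - s) A1 g(s) ds] is the convolution of the
    derivative of [g] plus [T(t) A1 g(0)].  Only right derivatives, uniform on
    bounded intervals, are needed.  Local boundedness of the semigroup comes
    from completeness, by nested balls. *)

(** * Identities and estimates in real normed modules *)

Inductive vexp : Type :=
  | VVar (n : nat)
  | VZero
  | VPlus (a b : vexp)
  | VOpp (a : vexp)
  | VScal (r : R) (a : vexp).

Fixpoint veval {V : ModuleSpace R_Ring} (l : list V) (e : vexp) : V :=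
  match e with
  | VVar n => nth n l zero
  | VZero => zero
  | VPlus a b => plus (veval l a) (veval l b)
  | VOpp a => opp (veval l a)
  | VScal r a => scal r (veval l a)
  end.

Fixpoint vcoef (e : vexp) (i : nat) : R :=
  match e with
  | VVar n => if Nat.eqb i n then 1 else 0
  | VZero => 0
  | VPlus a b => vcoef a i + vcoef b i
  | VOpp a => - vcoef a i
  | VScal r a => r * vcoef a i
  end.

Fixpoint lincomb {V : ModuleSpace R_Ring} (c : nat -> R) (l : list V) : V :=
  match l with
  | nil => zero
  | cons x l' => plus (scal (c O) x) (lincomb (fun i => c (S i)) l')
  end.

(** Recursion on the number of atoms lets [cbn] unfold this into a finite conjunction of real
    equations, small enough for [ring] or [field]. *)
Fixpoint coef_eq (c d : nat -> R) (k : nat) : Prop :=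
  match k with
  | O => True
  | S k' => c O = d O /\ coef_eq (fun i => c (S i)) (fun i => d (S i)) k'
  end.

Section VectorReflection.

Context {V : ModuleSpace R_Ring}.

Lemma lincomb_ext (l : list V) (c d : nat -> R) :
  coef_eq c d (length l) -> lincomb c l = lincomb d l.
Proof.
  revert c d; induction l as [|x l IH]; intros c d H; [reflexivity|].
  destruct H as [H0 H1]; cbn [lincomb]; rewrite H0, (IH _ _ H1); reflexivity.
Qed.

Lemma lincomb_zero (l : list V) : lincomb (fun _ => 0) l = zero.
Proof.
  induction l as [|x l IH]; [reflexivity|].
  cbn [lincomb]; rewrite IH, plus_zero_r; exact (scal_zero_l x).
Qed.

Lemma lincomb_scal (l : list V) (r : R) (c : nat -> R) :
  lincomb (fun i => r * c i) l = scal r (lincomb c l).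
Proof.
  revert c; induction l as [|x l IH]; intros c; cbn [lincomb].
  - symmetry; apply scal_zero_r.
  - rewrite (IH (fun i => c (S i))), scal_distr_l, scal_assoc; reflexivity.
Qed.

Lemma lincomb_plus (l : list V) (c d : nat -> R) :
  lincomb (fun i => c i + d i) l = plus (lincomb c l) (lincomb d l).
Proof.
  revert c d; induction l as [|x l IH]; intros c d; cbn [lincomb].
  - symmetry; apply plus_zero_r.
  - rewrite (IH (fun i => c (S i)) (fun i => d (S i))).
    rewrite (scal_distr_r (c O) (d O) x : scal (c O + d O) x = _).
    rewrite <- !plus_assoc; f_equal.
    rewrite !plus_assoc; f_equal; apply plus_comm.
Qed.

Lemma lincomb_opp (l : list V) (c : nat -> R) :
  lincomb (fun i => - c i) l = opp (lincomb c l).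
Proof.
  rewrite <- scal_opp_one, <- lincomb_scal; apply lincomb_ext.
  generalize (length l); intros k; revert c.
  induction k as [|k IH]; intros c; cbn; [exact I|].
  split; [unfold opp, one; cbn; ring|]; exact (IH (fun i => c (S i))).
Qed.

Lemma lincomb_var (l : list V) (n : nat) :
  lincomb (fun i => if Nat.eqb i n then 1 else 0) l = nth n l zero.
Proof.
  revert n; induction l as [|x l IH]; intros [|n]; cbn; try reflexivity.
  - rewrite lincomb_zero, plus_zero_r; exact (scal_one x).
  - rewrite IH. rewrite (scal_zero_l x : scal 0 x = zero); apply plus_zero_l.
Qed.

Lemma veval_lincomb (l : list V) (e : vexp) : veval l e = lincomb (vcoef e) l.
Proof.
  induction e as [n| |a IHa b IHb|a IHa|r a IHa]; cbn [veval vcoef].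
  - symmetry; apply lincomb_var.
  - symmetry; apply lincomb_zero.
  - rewrite IHa, IHb; symmetry; apply (lincomb_plus l (vcoef a) (vcoef b)).
  - rewrite IHa; symmetry; apply (lincomb_opp l (vcoef a)).
  - rewrite IHa; symmetry; apply (lincomb_scal l r (vcoef a)).
Qed.

Lemma veval_eq (l : list V) (e f : vexp) :
  coef_eq (vcoef e) (vcoef f) (length l) -> veval l e = veval l f.
Proof. intros H; rewrite !veval_lincomb; apply lincomb_ext; exact H. Qed.

End VectorReflection.

Ltac vec_insert x l :=
  lazymatch l with
  | nil => constr:(cons x nil)
  | cons x _ => l
  | cons ?y ?l' => let l'' := vec_insert x l' in constr:(cons y l'')
  end.

Ltac vec_atoms e l :=
  lazymatch e with
  | @plus _ ?a ?b => let l' := vec_atoms a l in vec_atoms b l'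
  | @minus _ ?a ?b => let l' := vec_atoms a l in vec_atoms b l'
  | @opp _ ?a => vec_atoms a l
  | @scal _ _ _ ?a => vec_atoms a l
  | @zero _ => l
  | _ => vec_insert e l
  end.

Ltac vec_index x l :=
  lazymatch l with
  | cons x _ => constr:(O)
  | cons _ ?l' => let n := vec_index x l' in constr:(S n)
  end.

Ltac vec_reify e l :=
  lazymatch e with
  | @plus _ ?a ?b =>
      let a' := vec_reify a l in let b' := vec_reify b l in
      constr:(VPlus a' b')
  | @minus _ ?a ?b =>
      let a' := vec_reify a l in let b' := vec_reify b l in
      constr:(VPlus a' (VOpp b'))
  | @opp _ ?a => let a' := vec_reify a l in constr:(VOpp a')
  | @scal _ _ ?r ?a => let a' := vec_reify a l in constr:(VScal r a')
  | @zero _ => constr:(VZero)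
  | _ => let n := vec_index e l in constr:(VVar n)
  end.

(** Proves an identity between linear combinations in a real module by
    comparing, atom by atom, the real coefficients on both sides. *)
Ltac vec :=
  lazymatch goal with
  | |- @eq ?A ?x ?y =>
      let l0 := vec_atoms x (@nil A) in
      let l := vec_atoms y l0 in
      let ex := vec_reify x l in
      let ey := vec_reify y l in
      refine (veval_eq l ex ey _);
      cbn [vcoef coef_eq length Nat.eqb];
      repeat split; try ring; try (field; lra)
  end.

(** * Norm estimates, continuity and integrals of vector-valued functions *)

Section Basics.

Context {Y : CompleteNormedModule R_AbsRing}.
Implicit Types (x y z : Y) (f g : R -> Y) (a b c r s t : R) (D : R -> Prop).

Lemma norm_le_plus x y a b :
  norm x <= a -> norm y <= b -> norm (plus x y) <= a + b.
Proof.
  intros Hx Hy; apply Rle_trans with (1 := norm_triangle x y); lra.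
Qed.

Lemma norm_le_scal r x c : norm x <= c -> norm (scal r x) <= Rabs r * c.
Proof.
  intros H; apply Rle_trans with (1 := norm_scal r x).
  apply Rmult_le_compat_l; [apply Rabs_pos | exact H].
Qed.

(** The normed-module axioms give one inequality; the other follows by applying it to the scalar
    [/ r] and the vector [scal r x]. *)
Lemma norm_scal_abs r x : norm (scal r x) = Rabs r * norm x.
Proof.
  apply Rle_antisym; [exact (norm_scal r x)|].
  destruct (Req_dec r 0) as [-> | Hr].
  { rewrite Rabs_R0, Rmult_0_l; apply norm_ge_0. }
  assert (Hp : 0 < Rabs r) by (apply Rabs_pos_lt; exact Hr).
  replace x with (scal (/ r) (scal r x)) at 1 by vec.
  apply Rle_trans with (Rabs r * (Rabs (/ r) * norm (scal r x))).
  - apply Rmult_le_compat_l; [lra | exact (norm_scal (/ r) (scal r x))].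
  - rewrite Rabs_inv; apply Req_le; field; lra.
Qed.

Lemma norm_minus_sym x y : norm (minus x y) = norm (minus y x).
Proof. rewrite <- (norm_opp (minus x y)); f_equal; vec. Qed.

Lemma norm_of_zero : norm (zero : Y) = 0.
Proof. exact (@norm_zero R_AbsRing Y). Qed.

Lemma norm_minus_diag x : norm (minus x x) = 0.
Proof. replace (minus x x) with (zero : Y) by vec; exact norm_of_zero. Qed.

Lemma norm_le_minus x y a b :
  norm x <= a -> norm y <= b -> norm (minus x y) <= a + b.
Proof.
  intros Hx Hy; apply norm_le_plus; [exact Hx|].
  exact (Rle_trans _ _ _ (Req_le _ _ (norm_opp y)) Hy).
Qed.

Lemma norm_minus_le_trans x y z a b :
  norm (minus x y) <= a -> norm (minus y z) <= b -> norm (minus x z) <= a + b.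
Proof.
  intros Ha Hb; replace (minus x z) with (plus (minus x y) (minus y z)) by vec.
  apply norm_le_plus; assumption.
Qed.

Lemma norm_le_of_minus x y a b :
  norm (minus x y) <= a -> norm y <= b -> norm x <= a + b.
Proof.
  intros Hxy Hy; replace x with (plus (minus x y) y) by vec.
  apply norm_le_plus; assumption.
Qed.

Lemma norm_le_eps x : (forall eps, 0 < eps -> norm x <= eps) -> x = zero.
Proof.
  intros H; refine (norm_eq_zero (x : Y) _); apply Rle_antisym; [|apply norm_ge_0].
  apply le_epsilon; intros eps Heps; rewrite Rplus_0_l; exact (H eps Heps).
Qed.

Lemma minus_eq_zero_iff x y : minus x y = zero <-> x = y.
Proof.
  split; intros H.
  - replace x with (plus (minus x y) y) by vec; rewrite H; vec.
  - rewrite H; vec.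
Qed.

(** Coquelicot states linearity over [NormedModule]; these versions use the
    instances that elaboration finds for a complete module, so that rewriting
    with them works. *)
Lemma linear_add (F : Y -> Y) : is_linear F ->
  forall x y, F (plus x y) = plus (F x) (F y).
Proof. intros HF; exact (linear_plus F HF). Qed.

Lemma linear_scale (F : Y -> Y) : is_linear F ->
  forall (r : R) x, F (scal r x) = scal r (F x).
Proof. intros HF; exact (linear_scal F HF). Qed.

Lemma linear_sub (F : Y -> Y) : is_linear F ->
  forall x y, F (minus x y) = minus (F x) (F y).
Proof.
  intros HF x y; replace (minus x y) with (plus x (scal (-1) y)) by vec.
  rewrite (linear_add F HF), (linear_scale F HF); vec.
Qed.

Lemma linear_at_zero (F : Y -> Y) : is_linear F -> F zero = zero.
Proof.
  intros HF; transitivity (F (scal 0 zero)); [f_equal; vec|].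
  rewrite (linear_scale F HF); vec.
Qed.

Lemma continuous_on_eps_delta D f :
  continuous_on D f <->
  forall x : R, D x -> forall eps, 0 < eps -> exists delta, 0 < delta /\
    forall y : R, D y -> Rabs (y - x) < delta ->
      norm (minus (f y) (f x)) < eps.
Proof.
  split.
  - intros H x Hx eps Heps.
    pose proof (proj1 (filterlim_locally_ball_norm f (f x)) (H x Hx)
      (mkposreal eps Heps)) as [delta Hdelta].
    exists delta; split; [apply cond_pos|].
    intros y Hy Hyx; exact (Hdelta y Hyx Hy).
  - intros H x Hx; apply (filterlim_locally_ball_norm f (f x)).
    intros eps; destruct (H x Hx eps (cond_pos eps)) as [delta [Hd Hdelta]].
    exists (mkposreal delta Hd); intros y Hy HDy; exact (Hdelta y HDy Hy).
Qed.

(** Covers the three changes of time in the proof: translation, reflection [t - s], and the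
    truncation [Rmax 0 (t - c)]. *)
Lemma continuous_on_comp_contraction (D E : R -> Prop) (p : R -> R) f :
  (forall r s, Rabs (p r - p s) <= Rabs (r - s)) ->
  (forall s, E s -> D (p s)) -> continuous_on D f ->
  continuous_on E (fun s => f (p s)).
Proof.
  intros Hp HE; rewrite !continuous_on_eps_delta; intros H x Hx eps Heps.
  destruct (H (p x) (HE x Hx) eps Heps) as [delta [Hd Hdelta]].
  exists delta; split; [exact Hd|]; intros y Hy Hyx.
  apply Hdelta; [exact (HE y Hy)|].
  apply Rle_lt_trans with (2 := Hyx); apply Hp.
Qed.

Lemma continuous_on_shift D E f h :
  (forall s, E s -> D (s + h)) -> continuous_on D f ->
  continuous_on E (fun s => f (s + h)).
Proof.
  apply (continuous_on_comp_contraction D E (fun s => s + h)).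
  intros r s; right; f_equal; ring.
Qed.

Lemma continuous_on_reflect D E f t :
  (forall s, E s -> D (t - s)) -> continuous_on D f ->
  continuous_on E (fun s => f (t - s)).
Proof.
  apply (continuous_on_comp_contraction D E (fun s => t - s)).
  intros r s; right; rewrite Rabs_minus_sym; f_equal; ring.
Qed.

Lemma continuous_on_minus D f g :
  continuous_on D f -> continuous_on D g ->
  continuous_on D (fun s => minus (f s) (g s)).
Proof.
  rewrite !continuous_on_eps_delta; intros Hf Hg x Hx eps Heps.
  destruct (Hf x Hx (eps / 2)) as [d1 [Hd1 H1]]; [lra|].
  destruct (Hg x Hx (eps / 2)) as [d2 [Hd2 H2]]; [lra|].
  exists (Rmin d1 d2); split; [apply Rmin_pos; assumption|]; intros y Hy Hyx.
  specialize (H1 y Hy (Rlt_le_trans _ _ _ Hyx (Rmin_l _ _))).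
  specialize (H2 y Hy (Rlt_le_trans _ _ _ Hyx (Rmin_r _ _))).
  replace (minus (minus (f y) (g y)) (minus (f x) (g x)))
    with (minus (minus (f y) (f x)) (minus (g y) (g x))) by vec.
  apply Rle_lt_trans with (1 := norm_le_minus _ _ _ _ (Rle_refl _) (Rle_refl _)).
  lra.
Qed.

Lemma continuous_on_linear D f (F : Y -> Y) : is_linear F ->
  continuous_on D f -> continuous_on D (fun s => F (f s)).
Proof.
  intros HF; rewrite !continuous_on_eps_delta; intros Hf x Hx eps Heps.
  destruct (linear_norm F HF) as [M [HM HFM]].
  destruct (Hf x Hx (eps / M)) as [d [Hd H]]; [apply Rdiv_lt_0_compat; lra|].
  exists d; split; [exact Hd|]; intros y Hy Hyx; specialize (H y Hy Hyx).
  rewrite <- linear_sub by exact HF.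
  apply Rle_lt_trans with (1 := HFM _).
  replace eps with (M * (eps / M)) by (field; lra).
  apply Rmult_lt_compat_l; assumption.
Qed.

Lemma continuous_on_scal D f r :
  continuous_on D f -> continuous_on D (fun s => scal r (f s)).
Proof.
  apply (continuous_on_linear D f (fun x => scal r x)).
  exact (is_linear_scal_r (V := Y) r Rmult_comm).
Qed.

(** Composition with the projection onto [a, b] makes a function that is
    continuous on [a, b] continuous on the whole line. *)
Definition clamp a b s := Rmax a (Rmin b s).

Lemma clamp_id a b s : a <= s <= b -> clamp a b s = s.
Proof. intros H; unfold clamp; rewrite Rmin_right, Rmax_right; lra. Qed.

Lemma continuous_clamp a b f : a <= b ->
  continuous_on (fun s => a <= s <= b) f ->
  forall s, continuous (fun r => f (clamp a b r)) s.
Proof.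
  intros Hab; rewrite continuous_on_eps_delta; intros H s.
  assert (Hc : forall r, a <= clamp a b r <= b)
    by (intros r; unfold clamp, Rmax, Rmin; repeat destruct Rle_dec; lra).
  apply (filterlim_locally_ball_norm (F := locally s)
    (fun r => f (clamp a b r)) (f (clamp a b s))).
  intros eps; destruct (H _ (Hc s) eps (cond_pos eps)) as [delta [Hd Hdelta]].
  exists (mkposreal delta Hd); intros r Hr; apply Hdelta; [exact (Hc r)|].
  apply Rle_lt_trans with (Rabs (r - s)); [|exact Hr].
  unfold clamp, Rmax, Rmin, Rabs; repeat destruct Rle_dec;
    repeat destruct Rcase_abs; lra.
Qed.

Lemma ex_RInt_continuous_on a b f : a <= b ->
  continuous_on (fun s => a <= s <= b) f -> ex_RInt f a b.
Proof.
  intros Hab H; apply ex_RInt_ext with (fun r => f (clamp a b r)).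
  - rewrite Rmin_left, Rmax_right by lra; intros r Hr.
    rewrite clamp_id; [reflexivity | lra].
  - apply ex_RInt_continuous; intros z _; apply continuous_clamp; assumption.
Qed.

Lemma continuous_on_bounded a b f : a <= b ->
  continuous_on (fun s => a <= s <= b) f ->
  exists M, 0 < M /\ forall s, a <= s <= b -> norm (f s) <= M.
Proof.
  intros Hab H.
  destruct (bounded_continuity (fun r => f (clamp a b r)) a b) as [M HM].
  { intros s _; apply continuous_clamp; assumption. }
  exists M; assert (HM' : forall s, a <= s <= b -> norm (f s) < M).
  { intros s Hs; rewrite <- (clamp_id a b s Hs) at 1; apply HM; exact Hs. }
  split; [|intros s Hs; left; apply HM'; exact Hs].
  apply Rle_lt_trans with (norm (f a)); [apply norm_ge_0 | apply HM'; lra].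
Qed.

Lemma norm_RInt_minus_scal f a b x c : a <= b -> ex_RInt f a b ->
  (forall s, a <= s <= b -> norm (minus (f s) x) <= c) ->
  norm (minus (RInt f a b) (scal (b - a) x)) <= (b - a) * c.
Proof.
  intros Hab Hf H.
  refine (norm_RInt_le_const (fun s => minus (f s) x) a b _ c Hab H _).
  refine (is_RInt_minus f (fun _ => x) a b _ _ _ _).
  - exact (RInt_correct f a b Hf).
  - exact (is_RInt_const a b x).
Qed.

Lemma norm_RInt_le_bound f a b c : a <= b -> ex_RInt f a b ->
  (forall s, a <= s <= b -> norm (f s) <= c) ->
  norm (RInt f a b) <= (b - a) * c.
Proof.
  intros Hab Hf H; exact (norm_RInt_le_const f a b _ c Hab H (RInt_correct f a b Hf)).
Qed.

(** Linear substitution with slope -1: its sign cancels the sign from exchanging the end points. *)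
Lemma is_RInt_reflect f a b c x :
  is_RInt f (c - b) (c - a) x -> is_RInt (fun s => f (c - s)) a b x.
Proof.
  intros H; apply (is_RInt_swap (V := Y)) in H.
  replace (c - a) with (-1 * a + c) in H by ring.
  replace (c - b) with (-1 * b + c) in H by ring.
  apply (is_RInt_comp_lin (V := Y)) in H.
  apply (is_RInt_scal (V := Y) _ _ _ (-1)) in H.
  replace x with (scal (-1) (opp x)) by vec.
  refine (is_RInt_ext (V := Y) _ _ _ _ _ _ H); intros s _.
  replace (-1 * s + c) with (c - s) by ring; vec.
Qed.

Lemma norm_minus_scal_of_quotient x y c h : 0 < h ->
  norm (minus (scal (/ h) x) y) <= c -> norm (minus x (scal h y)) <= c * h.
Proof.
  intros Hh H; replace (minus x (scal h y))
    with (scal h (minus (scal (/ h) x) y)) by vec.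
  pose proof (norm_le_scal h _ _ H) as H'.
  rewrite Rabs_pos_eq, Rmult_comm in H' by lra; exact H'.
Qed.

Lemma minus_scal_neg x y h : minus x (scal (- h) y) = plus x (scal h y).
Proof. vec. Qed.

(** Strong continuity and a uniform bound suffice, since [P r (g r) - P s (g s)] splits into [P r]
    applied to an increment of [g] and an increment of [P] at the fixed vector [g s]. *)
Lemma continuous_on_family_apply D (P : R -> Y -> Y) g M :
  (forall s, D s -> forall x y, P s (minus x y) = minus (P s x) (P s y)) ->
  (forall s, D s -> forall x, norm (P s x) <= M * norm x) ->
  0 < M ->
  (forall x, continuous_on D (fun s => P s x)) ->
  continuous_on D g -> continuous_on D (fun s => P s (g s)).
Proof.
  intros Hlin Hbd HM HP; rewrite !continuous_on_eps_delta; intros Hg s Hs eps Heps.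
  assert (Heps' : 0 < eps / (2 * M)) by (apply Rdiv_lt_0_compat; lra).
  destruct (Hg s Hs _ Heps') as [d1 [Hd1 H1]].
  destruct (proj1 (continuous_on_eps_delta _ _) (HP (g s)) s Hs (eps / 2))
    as [d2 [Hd2 H2]]; [lra|].
  exists (Rmin d1 d2); split; [apply Rmin_pos; assumption|]; intros r Hr Hrs.
  specialize (H1 r Hr (Rlt_le_trans _ _ _ Hrs (Rmin_l _ _))).
  specialize (H2 r Hr (Rlt_le_trans _ _ _ Hrs (Rmin_r _ _))).
  replace (minus (P r (g r)) (P s (g s)))
    with (plus (P r (minus (g r) (g s))) (minus (P r (g s)) (P s (g s))))
    by (rewrite Hlin by exact Hr; vec).
  specialize (Hbd r Hr (minus (g r) (g s))).
  assert (M * norm (minus (g r) (g s)) < M * (eps / (2 * M)))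
    by (apply Rmult_lt_compat_l; assumption).
  replace (M * (eps / (2 * M))) with (eps / 2) in * by (field; lra).
  apply Rle_lt_trans with (1 := norm_le_plus _ _ _ _ Hbd (Rlt_le _ _ H2)); lra.
Qed.

(** The right derivative alone suffices because the set of [r] up to which
    the estimate [norm (f s - f a) <= eps * (s - a)] holds is closed by left
    continuity and open to the right by the derivative bound. *)
Lemma right_derivative_zero_constant f a b : a <= b ->
  (forall r, a <= r < b -> forall eps, 0 < eps -> exists delta, 0 < delta /\
     forall h, 0 < h < delta -> norm (minus (f (r + h)) (f r)) <= eps * h) ->
  (forall r, a < r <= b -> forall eps, 0 < eps -> exists delta, 0 < delta /\
     forall h, 0 < h < delta -> norm (minus (f (r - h)) (f r)) <= eps) ->
  f b = f a.
Proof.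
  intros Hab Hder Hleft; apply minus_eq_zero_iff, norm_le_eps; intros eps0 Heps0.
  (* The added 1 keeps the denominator positive when [a = b]. *)
  set (eps := eps0 / (b - a + 1)).
  assert (Heps : 0 < eps) by (apply Rdiv_lt_0_compat; lra).
  assert (Hfin : eps * (b - a) <= eps0).
  { unfold eps; apply Rmult_le_reg_r with (b - a + 1); [lra|].
    replace (eps0 / (b - a + 1) * (b - a) * (b - a + 1)) with (eps0 * (b - a))
      by (field; lra). nra. }
  set (E := fun r => a <= r <= b /\ forall s, a <= s <= r ->
                norm (minus (f s) (f a)) <= eps * (s - a)).
  assert (HEa : E a).
  { split; [lra|]; intros s Hs; replace s with a by lra.
    rewrite norm_minus_diag; lra. }
  destruct (completeness E) as [m [Hub Hlub]].
  { exists b; intros r [Hr _]; lra. }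
  { exists a; exact HEa. }
  assert (Ham : a <= m) by (apply Hub; exact HEa).
  assert (Hmb : m <= b) by (apply Hlub; intros r [Hr _]; lra).
  assert (Hlt : forall s, a <= s < m -> norm (minus (f s) (f a)) <= eps * (s - a)).
  { intros s Hs; destruct (classic (exists r, E r /\ s < r)) as [[r [HEr Hsr]]|Hn].
    - apply HEr; lra.
    - exfalso; assert (m <= s); [|lra]; apply Hlub; intros r Hr.
      destruct (Rle_lt_dec r s); [assumption|]; exfalso; apply Hn; exists r; auto. }
  assert (Hm : norm (minus (f m) (f a)) <= eps * (m - a)).
  { destruct (Req_dec m a) as [-> | Hne]; [apply HEa; lra|].
    apply le_epsilon; intros e He.
    destruct (Hleft m ltac:(lra) e He) as [d [Hd Hdl]].
    set (h := Rmin d (m - a) / 2).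
    assert (Hh : 0 < Rmin d (m - a)) by (apply Rmin_pos; lra).
    pose proof (Rmin_l d (m - a)); pose proof (Rmin_r d (m - a)).
    specialize (Hdl h ltac:(unfold h; lra)); rewrite norm_minus_sym in Hdl.
    specialize (Hlt (m - h) ltac:(unfold h; lra)).
    assert (0 <= eps * h) by (apply Rmult_le_pos; unfold h; lra).
    pose proof (norm_minus_le_trans _ _ _ _ _ Hdl Hlt); lra. }
  assert (HEm : E m).
  { split; [lra|]; intros s Hs; destruct (Req_dec s m) as [-> | Hne];
      [exact Hm | apply Hlt; lra]. }
  destruct (Req_dec m b) as [<- | Hne]; [lra|]; exfalso.
  destruct (Hder m ltac:(lra) eps Heps) as [d [Hd Hdr]].
  set (h := Rmin d (b - m) / 2).
  assert (Hh : 0 < Rmin d (b - m)) by (apply Rmin_pos; lra).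
  pose proof (Rmin_l d (b - m)); pose proof (Rmin_r d (b - m)).
  assert (HE : E (m + h)); [|apply Hub in HE; unfold h in HE; lra].
  split; [unfold h; lra|]; intros s Hs.
  destruct (Rle_lt_dec s m) as [Hsm|Hsm]; [apply HEm; lra|].
  specialize (Hdr (s - m) ltac:(unfold h in Hs; lra)).
  replace (m + (s - m)) with s in Hdr by ring.
  pose proof (norm_minus_le_trans _ _ _ _ _ Hdr Hm); lra.
Qed.

End Basics.

(** * Uniform boundedness and semigroups *)

Section UniformBoundedness.

Context {Y : CompleteNormedModule R_AbsRing}.

(** The last hypothesis puts each closed ball inside the preceding one. The radii shrink
    geometrically, so the centres form a Cauchy sequence, and its limit stays in every ball. *)
Lemma nested_balls (x : nat -> Y) (r : nat -> R) :
  (forall n, 0 < r n) -> (forall n, r (S n) <= r n / 2) ->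
  (forall n, norm (minus (x (S n)) (x n)) + r (S n) <= r n) ->
  exists z, forall n, norm (minus z (x n)) <= r n.
Proof.
  intros Hpos Hhalf Hnest.
  assert (Hx : forall n k, norm (minus (x (n + k)%nat) (x n)) + r (n + k)%nat <= r n).
  { intros n k; induction k as [|k IH].
    - rewrite Nat.add_0_r, norm_minus_diag; lra.
    - rewrite Nat.add_succ_r; specialize (Hnest (n + k)%nat).
      pose proof (norm_minus_le_trans _ _ _ _ _
        (Rle_refl (norm (minus (x (S (n + k))) (x (n + k)%nat))))
        (Rle_refl (norm (minus (x (n + k)%nat) (x n))))); lra. }
  assert (Hr : forall eps, 0 < eps -> exists N, r N < eps).
  { assert (Hpow : forall n, r n <= r O * (1 / 2) ^ n).
    { induction n as [|n IH]; cbn [pow]; [lra|]; specialize (Hhalf n); lra. }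
    intros eps Heps.
    destruct (pow_lt_1_zero (1 / 2) ltac:(rewrite Rabs_pos_eq; lra) (eps / r O))
      as [N HN]; [apply Rdiv_lt_0_compat; auto|].
    exists N; specialize (HN N (Nat.le_refl N)); apply Rle_lt_trans with (1 := Hpow N).
    rewrite Rabs_pos_eq in HN by (apply pow_le; lra).
    pose proof (Hpos O) as H0.
    replace eps with (r O * (eps / r O)) by (field; lra).
    apply Rmult_lt_compat_l; assumption. }
  assert (Hlim : exists z, filterlim x eventually (locally z)).
  { apply (filterlim_locally_cauchy (F := eventually) x); intros eps.
    destruct (Hr (eps / 2)) as [N HN]; [pose proof (cond_pos eps); lra|].
    exists (fun m => (N <= m)%nat); split; [exists N; auto|].
    assert (HxN : forall m, (N <= m)%nat -> norm (minus (x m) (x N)) < eps / 2).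
    { intros m Hm; specialize (Hx N (m - N)%nat).
      replace (N + (m - N))%nat with m in Hx by lia.
      pose proof (Hpos m); lra. }
    intros m p Hm Hp; refine (norm_compat1 (V := Y) (x m) (x p) eps _).
    pose proof (HxN m Hm) as H1; pose proof (HxN p Hp) as H2.
    rewrite norm_minus_sym in H1.
    refine (Rle_lt_trans _ _ _ (norm_minus_le_trans (x p) (x N) (x m) _ _
      (Rle_refl _) (Rle_refl _)) _); lra. }
  destruct Hlim as [z Hz]; exists z; intros n; apply le_epsilon; intros e He.
  destruct (proj1 (filterlim_locally_ball_norm x z) Hz (mkposreal e He)) as [N HN].
  specialize (HN (n + N)%nat ltac:(lia)).
  change (norm (minus (x (n + N)%nat) z) < e) in HN.
  rewrite norm_minus_sym in HN.
  specialize (Hx n N); pose proof (Hpos (n + N)%nat).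
  pose proof (norm_minus_le_trans z (x (n + N)%nat) (x n) _ _
    (Rlt_le _ _ HN) (Rle_refl _)).
  lra.
Qed.

(** Rescale [v] to a vector [w] of norm [r], so that [F w] has norm at least [M]. As
    [2 F w = F (x + w) - F (x - w)], one of the points [x + w] and [x - w] must do. *)
Lemma unbounded_on_ball (F : Y -> Y) (x : Y) (r M : R) :
  is_linear F -> 0 < r -> 0 < M ->
  (exists v, M / r * norm v < norm (F v)) ->
  exists y, norm (minus y x) <= r /\ M <= norm (F y).
Proof.
  intros HF Hr HM [v Hv].
  assert (Hv0 : 0 < norm v).
  { destruct (Req_dec (norm v) 0) as [H0|H0]; [|pose proof (norm_ge_0 v); lra].
    exfalso; assert (E : F v = zero).
    { rewrite (norm_eq_zero (v : Y) H0 : v = zero); apply linear_at_zero; exact HF. }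
    rewrite E, H0, norm_of_zero in Hv; lra. }
  set (w := scal (r / norm v) v : Y).
  assert (Hw : norm w = r).
  { transitivity (Rabs (r / norm v) * norm v); [exact (norm_scal_abs _ v)|].
    rewrite Rabs_pos_eq; [field; lra | left; apply Rdiv_lt_0_compat; lra]. }
  assert (HFw : M <= norm (F w)).
  { assert (E : norm (F w) = r / norm v * norm (F v)).
    { transitivity (norm (scal (r / norm v) (F v)));
        [f_equal; exact (linear_scale F HF _ v)|].
      transitivity (Rabs (r / norm v) * norm (F v)); [exact (norm_scal_abs _ _)|].
      rewrite Rabs_pos_eq; [reflexivity | left; apply Rdiv_lt_0_compat; lra]. }
    rewrite E; replace M with (r / norm v * (M / r * norm v)) at 1 by (field; lra).
    apply Rmult_le_compat_l; [left; apply Rdiv_lt_0_compat; lra | lra]. }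
  destruct (Rle_lt_dec M (norm (F (plus x w)))) as [H1|H1].
  { exists (plus x w); split; [|exact H1].
    replace (minus (plus x w) x) with w by vec; lra. }
  exists (minus x w); split.
  { replace (minus (minus x w) x) with (opp w) by vec.
    exact (Rle_trans _ _ _ (Req_le _ _ (norm_opp w)) (Req_le _ _ Hw)). }
  apply Rnot_lt_le; intros H2.
  assert (E : scal 2 (F w) = minus (F (plus x w)) (F (minus x w))).
  { rewrite (linear_add F HF), (linear_sub F) by exact HF; vec. }
  pose proof (norm_le_minus (F (plus x w)) (F (minus x w)) _ _
    (Rle_refl _) (Rle_refl _)) as H.
  rewrite <- E in H; pose proof (norm_scal_abs 2 (F w)) as H3.
  rewrite Rabs_pos_eq in H3; lra.
Qed.

(** Nested balls are built so that some member of [P n] is at least [INR n] in norm on the whole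
    ball chosen at step [n]. A common point of all the balls serves every [n] at once. *)
Lemma condensation_of_singularities (P : nat -> (Y -> Y) -> Prop) :
  (forall n F, P n F -> is_linear F) ->
  (forall n M, 0 < M -> exists F x, P n F /\ M * norm x < norm (F x)) ->
  exists z, forall n, exists F, P n F /\ INR n <= norm (F z).
Proof.
  intros Hlin Hunb.
  set (Q := fun (n : nat) (p q : Y * R) => 0 < snd q <= snd p / 2 /\
    norm (minus (fst q) (fst p)) + snd q <= snd p /\
    exists F, P n F /\
      forall y, norm (minus y (fst q)) <= snd q -> INR n <= norm (F y)).
  (* The positivity of the radius stands inside the existential, so that choice yields a total step
     function for [nat_rect]. *)
  assert (Hstep : forall n p, exists q, 0 < snd p -> Q n p q).
  { intros n [x r]; cbn; destruct (Rlt_dec 0 r) as [Hr|Hr];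
      [|exists (x, r); tauto].
    (* The value [INR n + 1] is reached at the new centre; on a ball of radius [/ K] the map [F]
       varies by at most 1, which leaves [INR n]. *)
    assert (Hn : 0 < INR n + 1) by (pose proof (pos_INR n); lra).
    destruct (Hunb n ((INR n + 1) / (r / 2))) as [F [v [HF Hv]]].
    { apply Rdiv_lt_0_compat; lra. }
    destruct (unbounded_on_ball F x (r / 2) (INR n + 1) (Hlin n F HF)
      ltac:(lra) Hn (ex_intro _ v Hv)) as [y [Hy HFy]].
    destruct (linear_norm F (Hlin n F HF)) as [K [HK HFK]].
    assert (HK' : 0 < / K) by (apply Rinv_0_lt_compat; exact HK).
    pose proof (Rmin_l (r / 2) (/ K)); pose proof (Rmin_r (r / 2) (/ K)).
    exists (y, Rmin (r / 2) (/ K)); intros _; unfold Q; cbn.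
    split; [split; [apply Rmin_pos; lra | assumption]|].
    split; [lra|]; exists F; split; [exact HF|]; intros z Hz.
    assert (Hzy : norm (minus (F y) (F z)) <= 1).
    { rewrite norm_minus_sym, <- (linear_sub F) by exact (Hlin n F HF).
      apply Rle_trans with (1 := HFK (minus z y)).
      apply Rle_trans with (K * / K); [|right; field; lra].
      apply Rmult_le_compat_l; lra. }
    pose proof (norm_le_of_minus _ _ _ _ Hzy (Rle_refl _)); lra. }
  set (step := fun n p =>
    proj1_sig (constructive_indefinite_description _ (Hstep n p))).
  assert (HQ : forall n p, 0 < snd p -> Q n p (step n p)).
  { intros n p; exact (proj2_sig (constructive_indefinite_description _ (Hstep n p))). }
  set (s := nat_rect (fun _ => (Y * R)%type) (zero, 1) step).
  assert (Hs : forall n, 0 < snd (s n)).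
  { induction n as [|n IH]; [cbn; lra|]; apply (HQ n (s n) IH). }
  assert (HQs : forall n, Q n (s n) (s (S n))).
  { intros n; exact (HQ n (s n) (Hs n)). }
  destruct (nested_balls (fun n => fst (s n)) (fun n => snd (s n))) as [z Hz].
  - exact Hs.
  - intros n; apply (HQs n).
  - intros n; apply (HQs n).
  - exists z; intros n; destruct (HQs n) as [_ [_ [F [HF HFy]]]].
    exists F; split; [exact HF|]; apply HFy, (Hz (S n)).
Qed.

End UniformBoundedness.

Record strongly_continuous_semigroup {Y : CompleteNormedModule R_AbsRing}
    (T : R -> Y -> Y) : Prop := {
  sg_linear : forall t, 0 <= t -> is_linear (T t);
  sg_zero : forall x, T 0 x = x;
  sg_add : forall s t, 0 <= s -> 0 <= t -> forall x, T (s + t) x = T s (T t x);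
  sg_strong : forall x eps, 0 < eps -> exists delta, 0 < delta /\
    forall h, 0 <= h < delta -> norm (minus (T h x) x) <= eps
}.

Section Semigroup.

Context {Y : CompleteNormedModule R_AbsRing} {T : R -> Y -> Y}.
Hypothesis HT : strongly_continuous_semigroup T.

(** Strong continuity bounds [T t x] only for [t] below a threshold that depends
    on [x], so the singularities are condensed along times tending to [0]. *)
Lemma semigroup_bounded_near_0 : exists delta M, 0 < delta /\ 1 <= M /\
  forall t x, 0 <= t <= delta -> norm (T t x) <= M * norm x.
Proof.
  apply NNPP; intros Hn.
  destruct (condensation_of_singularities
    (fun n F => exists t, 0 <= t <= / (INR n + 1) /\ F = T t)) as [z Hz].
  - intros n F [t [Ht ->]]; apply (sg_linear T HT); lra.
  (* If the operators at times up to [/ (INR n + 1)] had the common bound [M], that time and the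
     bound [M + 1] would contradict [Hn]. *)
  - intros n M HM; apply NNPP; intros Hn'; apply Hn.
    exists (/ (INR n + 1)), (M + 1); split.
    { apply Rinv_0_lt_compat; pose proof (pos_INR n); lra. }
    split; [lra|]; intros t x Ht; apply Rnot_lt_le; intros Hlt; apply Hn'.
    exists (T t), x; split; [exists t; auto|].
    apply Rle_lt_trans with (2 := Hlt); pose proof (norm_ge_0 x); nra.
  - destruct (sg_strong T HT z 1 Rlt_0_1) as [d [Hd Hdz]].
    (* The index [n1 + n2] is large enough for the time to fall below [d], where [T t z] has norm at
       most [norm z + 1], and for the lower bound to exceed that value. *)
    destruct (INR_unbounded (/ d)) as [n1 Hn1].
    destruct (INR_unbounded (norm z + 1)) as [n2 Hn2].
    destruct (Hz (n1 + n2)%nat) as [F [[t [Ht ->]] Hbig]].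
    assert (Hid : 0 < / d) by (apply Rinv_0_lt_compat; exact Hd).
    rewrite plus_INR in *; pose proof (pos_INR n1); pose proof (pos_INR n2).
    assert (/ (INR n1 + INR n2 + 1) < d).
    { rewrite <- (Rinv_inv d); apply Rinv_lt_contravar;
        [apply Rmult_lt_0_compat|]; lra. }
    specialize (Hdz t ltac:(lra)).
    pose proof (norm_le_of_minus _ _ _ _ Hdz (Rle_refl (norm z))); lra.
Qed.

(** The interval is covered by steps of length [d]; by the semigroup law each further step
    multiplies the bound by [M]. *)
Lemma semigroup_bounded (L : R) : exists M, 1 <= M /\
  forall t x, 0 <= t <= L -> norm (T t x) <= M * norm x.
Proof.
  destruct semigroup_bounded_near_0 as [d [M [Hd [HM H]]]].
  destruct (INR_unbounded (L / d)) as [n Hn].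
  assert (Hpow : forall n, exists M', 1 <= M' /\
    forall t x, 0 <= t <= INR n * d -> norm (T t x) <= M' * norm x).
  { clear n Hn; induction n as [|n [M' [HM' IH]]].
    - exists M; split; [exact HM|]; intros t x Ht; apply H; cbn in Ht; lra.
    - exists (M * M'); split; [nra|]; intros t x Ht; rewrite S_INR in Ht.
      pose proof (norm_ge_0 x).
      destruct (Rle_lt_dec t (INR n * d)) as [Hle|Hlt].
      + apply Rle_trans with (1 := IH t x ltac:(lra)).
        apply Rmult_le_compat_r; nra.
      + pose proof (pos_INR n) as Hn; assert (0 <= INR n * d) by nra.
        replace t with ((t - INR n * d) + INR n * d) by ring.
        rewrite (sg_add T HT) by lra.
        apply Rle_trans with (1 := H (t - INR n * d) _ ltac:(lra)).
        rewrite Rmult_assoc; apply Rmult_le_compat_l; [lra|]; apply IH; lra. }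
  destruct (Hpow n) as [M' [HM' HT']]; exists M'; split; [exact HM'|].
  intros t x Ht; apply HT'; split; [lra|].
  apply Rle_trans with (1 := proj2 Ht); replace L with (L / d * d) by (field; lra).
  apply Rmult_le_compat_r; lra.
Qed.

End Semigroup.

(** * Convolution with the semigroup *)

Definition unif_continuous {Y : CompleteNormedModule R_AbsRing} (g : R -> Y)
    : Prop :=
  forall L eps, 0 < eps -> exists delta, 0 < delta /\ forall s h,
    0 <= s <= L -> 0 <= h < delta -> norm (minus (g (s + h)) (g s)) <= eps.

(** Uniformity in [s] lets the error estimate pass under the integral of a convolution. *)
Definition unif_right_derivative {Y : CompleteNormedModule R_AbsRing}
    (g dg : R -> Y) : Prop :=
  forall L eps, 0 < eps -> exists delta, 0 < delta /\ forall s h,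
    0 <= s <= L -> 0 < h < delta ->
    norm (minus (minus (g (s + h)) (g s)) (scal h (dg s))) <= eps * h.

Definition half_line (s : R) : Prop := 0 <= s.

Section Convolution.

Context {Y : CompleteNormedModule R_AbsRing} {T : R -> Y -> Y} {A1 : Y -> Y}.
Hypothesis HT : strongly_continuous_semigroup T.
Hypothesis HA1 : is_linear A1.

(** For [y < x] the forward estimate is used with base point [y]; its uniformity in the base point
    gives continuity from the left. *)
Lemma unif_continuous_continuous_on (g : R -> Y) :
  unif_continuous g -> continuous_on half_line g.
Proof.
  intros Hg; apply continuous_on_eps_delta; intros x Hx eps Heps.
  destruct (Hg (x + 1) (eps / 2)) as [d [Hd H]]; [lra|].
  exists (Rmin d 1); split; [apply Rmin_pos; lra|]; intros y Hy Hyx.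
  pose proof (Rmin_l d 1); pose proof (Rmin_r d 1).
  apply Rabs_lt_between in Hyx; unfold half_line in *.
  destruct (Rle_lt_dec x y).
  - specialize (H x (y - x) ltac:(lra) ltac:(lra)).
    replace (x + (y - x)) with y in H by ring; lra.
  - specialize (H y (x - y) ltac:(lra) ltac:(lra)).
    replace (y + (x - y)) with x in H by ring; rewrite norm_minus_sym; lra.
Qed.

Lemma semigroup_unif_continuous (x : Y) : unif_continuous (fun t => T t x).
Proof.
  intros L eps Heps; destruct (semigroup_bounded HT L) as [M [HM HTM]].
  destruct (sg_strong T HT x (eps / M)) as [d [Hd H]];
    [apply Rdiv_lt_0_compat; lra|].
  exists d; split; [exact Hd|]; intros s h Hs Hh.
  rewrite (sg_add T HT) by lra.
  rewrite <- (linear_sub (T s)) by (apply (sg_linear T HT); lra).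
  apply Rle_trans with (1 := HTM s _ Hs).
  replace eps with (M * (eps / M)) by (field; lra).
  apply Rmult_le_compat_l; [lra | apply H; lra].
Qed.

Lemma kernel_bounded (L : R) : exists K, 0 < K /\
  forall t x, 0 <= t <= L -> norm (T t (A1 x)) <= K * norm x.
Proof.
  destruct (semigroup_bounded HT L) as [M [HM HTM]].
  destruct (linear_norm A1 HA1) as [N [HN HAN]].
  exists (M * N); split; [apply Rmult_lt_0_compat; lra|]; intros t x Ht.
  apply Rle_trans with (1 := HTM t _ Ht); rewrite Rmult_assoc.
  apply Rmult_le_compat_l; [lra | apply HAN].
Qed.

Lemma kernel_ex_RInt (g : R -> Y) (a b t : R) : 0 <= a <= b -> b <= t ->
  continuous_on half_line g -> ex_RInt (fun s => T (t - s) (A1 (g s))) a b.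
Proof.
  intros Hab Hbt Hg; apply ex_RInt_continuous_on; [lra|].
  destruct (kernel_bounded (t - a)) as [K [HK HTK]].
  apply (continuous_on_family_apply _ (fun s x => T (t - s) (A1 x)) g K).
  - intros s Hs x y; rewrite (linear_sub A1) by exact HA1.
      apply (linear_sub (T (t - s))), (sg_linear T HT); lra.
  - intros s Hs x; apply HTK; lra.
  - exact HK.
  - intros x; apply (continuous_on_reflect half_line _ (fun r => T r (A1 x))).
    + intros s Hs; unfold half_line; lra.
    + apply unif_continuous_continuous_on, semigroup_unif_continuous.
  - apply continuous_on_subset with half_line; [unfold half_line; intros; lra | exact Hg].
Qed.

Definition conv (g : R -> Y) (t : R) : Y :=
  RInt (fun s => T (t - s) (A1 (g s))) 0 t.

Lemma conv_0 (g : R -> Y) : conv g 0 = zero.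
Proof. apply RInt_point. Qed.

Lemma conv_ext (f g : R -> Y) (t : R) : 0 <= t ->
  (forall s, 0 <= s <= t -> f s = g s) -> conv f t = conv g t.
Proof.
  intros Ht H; apply RInt_ext; rewrite Rmin_left, Rmax_right by lra.
  intros s Hs; rewrite H by lra; reflexivity.
Qed.

Lemma conv_plus (f g : R -> Y) (t : R) : 0 <= t ->
  continuous_on half_line f -> continuous_on half_line g ->
  conv (fun s => plus (f s) (g s)) t = plus (conv f t) (conv g t).
Proof.
  intros Ht Hf Hg; unfold conv.
  rewrite <- RInt_plus by (apply kernel_ex_RInt; try assumption; lra).
  apply RInt_ext; rewrite Rmin_left, Rmax_right by lra; intros s Hs.
  rewrite (linear_add A1) by exact HA1.
  apply (linear_add (T (t - s))), (sg_linear T HT); lra.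
Qed.

Lemma conv_scal (r : R) (g : R -> Y) (t : R) : 0 <= t ->
  continuous_on half_line g ->
  conv (fun s => scal r (g s)) t = scal r (conv g t).
Proof.
  intros Ht Hg; unfold conv.
  rewrite <- RInt_scal by (apply kernel_ex_RInt; try assumption; lra).
  apply RInt_ext; rewrite Rmin_left, Rmax_right by lra; intros s Hs.
  rewrite (linear_scale A1) by exact HA1.
  apply (linear_scale (T (t - s))), (sg_linear T HT); lra.
Qed.

Lemma conv_minus (f g : R -> Y) (t : R) : 0 <= t ->
  continuous_on half_line f -> continuous_on half_line g ->
  conv (fun s => minus (f s) (g s)) t = minus (conv f t) (conv g t).
Proof.
  intros Ht Hf Hg; transitivity (conv (fun s => plus (f s) (scal (-1) (g s))) t).
  - apply conv_ext; [exact Ht|]; intros s _; vec.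
  - rewrite conv_plus, conv_scal; try assumption; [vec|].
    apply continuous_on_scal; exact Hg.
Qed.

Lemma conv_bounded (L : R) : exists K, 0 < K /\ forall g t c,
  continuous_on half_line g -> 0 <= t <= L ->
  (forall s, 0 <= s <= t -> norm (g s) <= c) -> norm (conv g t) <= K * c.
Proof.
  destruct (kernel_bounded L) as [K [HK HTK]].
  (* The factor [Rabs L + 1] bounds the length of the interval and is positive for every real
     [L]. *)
  exists ((Rabs L + 1) * K); pose proof (Rabs_pos L); split; [nra|].
  intros g t c Hg Ht Hc.
  assert (Hc0 : 0 <= c).
  { apply Rle_trans with (norm (g 0)); [apply norm_ge_0 | apply Hc; lra]. }
  apply Rle_trans with ((t - 0) * (K * c)).
  - apply norm_RInt_le_bound; [lra | apply kernel_ex_RInt; try assumption; lra|].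
    intros s Hs; apply Rle_trans with (1 := HTK (t - s) (g s) ltac:(lra)).
    apply Rmult_le_compat_l; [lra | apply Hc; exact Hs].
  - rewrite Rmult_assoc; apply Rmult_le_compat_r; [nra|].
    pose proof (Rle_abs L); lra.
Qed.

(** The time shift is moved from the semigroup to [g]. An increment of [conv g] is thus the
    convolution of an increment of [g] plus an integral over [[0, h]], so regularity is asked of [g]
    and not of the orbits of [T]. *)
Lemma conv_shift (g : R -> Y) (t h : R) : 0 <= t -> 0 <= h ->
  continuous_on half_line g ->
  conv g (t + h) =
    plus (RInt (fun s => T (t + h - s) (A1 (g s))) 0 h)
         (conv (fun s => g (s + h)) t).
Proof.
  intros Ht Hh Hg; unfold conv.
  assert (E : RInt (fun s => T (t - s) (A1 (g (s + h)))) 0 t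
      = RInt (fun s => T (t + h - s) (A1 (g s))) h (t + h)).
  { pose proof (RInt_comp_lin (fun s => T (t + h - s) (A1 (g s))) 1 h 0 t) as E.
    replace (1 * 0 + h) with h in E by ring.
    replace (1 * t + h) with (t + h) in E by ring.
    rewrite <- E by (apply kernel_ex_RInt; try assumption; lra).
    apply RInt_ext; intros s _.
    replace (t + h - (1 * s + h)) with (t - s) by ring.
    replace (1 * s + h) with (s + h) by ring; symmetry; exact (scal_one _). }
  rewrite E; symmetry; apply (RInt_Chasles (V := Y));
    apply kernel_ex_RInt; try assumption; lra.
Qed.

(** With [T t] factored out and bounded, only [T (h - s)] for small [h - s] and [g] near 0 remain.
    This makes the estimate uniform in [t]. *)
Lemma kernel_RInt_small (g : R -> Y) : unif_continuous g ->
  forall L eps, 0 < eps -> exists delta, 0 < delta /\ forall t h,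
    0 <= t <= L -> 0 < h < delta ->
    norm (minus (RInt (fun s => T (t + h - s) (A1 (g s))) 0 h)
            (scal h (T t (A1 (g 0))))) <= eps * h.
Proof.
  intros Hg L eps Heps.
  destruct (semigroup_bounded HT L) as [M [HM HTM]].
  destruct (kernel_bounded 1) as [K [HK HTK]].
  destruct (Hg 0 (eps / (2 * M * K))) as [d1 [Hd1 H1]].
  { apply Rdiv_lt_0_compat; [lra|]; nra. }
  destruct (sg_strong T HT (A1 (g 0)) (eps / (2 * M))) as [d2 [Hd2 H2]].
  { apply Rdiv_lt_0_compat; lra. }
  exists (Rmin (Rmin d1 d2) 1); split; [repeat apply Rmin_pos; lra|].
  intros t h Ht Hh.
  pose proof (Rmin_l (Rmin d1 d2) 1); pose proof (Rmin_r (Rmin d1 d2) 1).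
  pose proof (Rmin_l d1 d2); pose proof (Rmin_r d1 d2).
  rewrite (Rmult_comm eps); replace h with (h - 0) at 2 3 by ring.
  apply norm_RInt_minus_scal; [lra| |].
  { apply kernel_ex_RInt; try lra; apply unif_continuous_continuous_on, Hg. }
  intros s Hs; replace (t + h - s) with (t + (h - s)) by ring.
  rewrite (sg_add T HT) by lra.
  rewrite <- (linear_sub (T t)) by (apply (sg_linear T HT); lra).
  apply Rle_trans with (1 := HTM t _ Ht).
  replace eps with (M * (K * (eps / (2 * M * K)) + eps / (2 * M)))
    by (field; split; lra).
  apply Rmult_le_compat_l; [lra|].
  apply norm_minus_le_trans with (T (h - s) (A1 (g 0))); [|apply H2; lra].
  rewrite <- (linear_sub (T (h - s))) by (apply (sg_linear T HT); lra).
  rewrite <- (linear_sub A1) by exact HA1.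
  apply Rle_trans with (1 := HTK (h - s) _ ltac:(lra)).
  apply Rmult_le_compat_l; [lra|].
  specialize (H1 0 s ltac:(lra) ltac:(lra)); rewrite Rplus_0_l in H1; exact H1.
Qed.

Lemma conv_unif_continuous (g : R -> Y) :
  unif_continuous g -> unif_continuous (conv g).
Proof.
  intros Hg L eps Heps.
  assert (Hgc := unif_continuous_continuous_on g Hg).
  destruct (conv_bounded L) as [K [HK Hconv]].
  destruct (Hg L (eps / (2 * K))) as [d1 [Hd1 H1]];
    [apply Rdiv_lt_0_compat; lra|].
  destruct (kernel_RInt_small g Hg L 1 Rlt_0_1) as [d2 [Hd2 H2]].
  destruct (kernel_bounded L) as [K' [HK' HTK]].
  (* The integral over [[0, h]] is at most [h * c]: the 1 is the error allowed in
     [kernel_RInt_small], and the rest bounds [T t (A1 (g 0))]. *)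
  set (c := 1 + K' * norm (g 0)).
  assert (Hc : 0 < c) by (unfold c; pose proof (norm_ge_0 (g 0)); nra).
  exists (Rmin (Rmin d1 d2) (eps / (2 * c))).
  split; [repeat apply Rmin_pos; try lra; apply Rdiv_lt_0_compat; lra|].
  intros t h Ht Hh.
  pose proof (Rmin_l (Rmin d1 d2) (eps / (2 * c))).
  pose proof (Rmin_r (Rmin d1 d2) (eps / (2 * c))).
  pose proof (Rmin_l d1 d2); pose proof (Rmin_r d1 d2).
  destruct (Req_dec h 0) as [-> | Hne].
  { rewrite Rplus_0_r, norm_minus_diag; lra. }
  rewrite conv_shift by (try assumption; lra).
  assert (Hgh : continuous_on half_line (fun s => g (s + h))).
  { apply continuous_on_shift with half_line;
      [unfold half_line; intros; lra | exact Hgc]. }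
  specialize (H2 t h Ht ltac:(lra)).
  specialize (HTK t (g 0) Ht).
  pose proof (norm_le_of_minus _ _ _ _ H2 (norm_le_scal h _ _ HTK)) as H6.
  rewrite Rabs_pos_eq in H6 by lra.
  assert (H7 : h * c <= eps / 2).
  { replace (eps / 2) with (eps / (2 * c) * c) by (field; lra).
    apply Rmult_le_compat_r; lra. }
  assert (H8 : norm (conv (fun s => minus (g (s + h)) (g s)) t)
      <= K * (eps / (2 * K))).
  { apply Hconv; [apply continuous_on_minus; assumption | exact Ht |].
    intros s Hs; apply H1; lra. }
  rewrite conv_minus in H8 by (try assumption; lra).
  replace (K * (eps / (2 * K))) with (eps / 2) in H8 by (field; lra).
  match goal with |- norm (minus (plus ?a ?b) ?d) <= _ =>
    replace (minus (plus a b) d) with (plus a (minus b d)) by vec end.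
  apply Rle_trans with (1 := norm_le_plus _ _ _ _ H6 H8).
  unfold c in H7; lra.
Qed.

(** In [conv_shift], the convolution of the difference quotient of [g] tends to [conv dg], and the
    mean of the kernel over [[0, h]] tends to the boundary term. *)
Lemma conv_right_derivative (g dg : R -> Y) :
  unif_continuous g -> continuous_on half_line dg ->
  unif_right_derivative g dg ->
  unif_right_derivative (conv g)
    (fun t => plus (conv dg t) (T t (A1 (g 0)))).
Proof.
  intros Hg Hdg Hder L eps Heps.
  assert (Hgc := unif_continuous_continuous_on g Hg).
  destruct (conv_bounded L) as [K [HK Hconv]].
  destruct (Hder L (eps / (2 * K))) as [d1 [Hd1 H1]];
    [apply Rdiv_lt_0_compat; lra|].
  destruct (kernel_RInt_small g Hg L (eps / 2)) as [d2 [Hd2 H2]]; [lra|].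
  exists (Rmin d1 d2); split; [apply Rmin_pos; lra|]; intros t h Ht Hh.
  pose proof (Rmin_l d1 d2); pose proof (Rmin_r d1 d2).
  rewrite conv_shift by (try assumption; lra).
  assert (Hgh : continuous_on half_line (fun s => g (s + h))).
  { apply continuous_on_shift with half_line;
      [unfold half_line; intros; lra | exact Hgc]. }
  specialize (H2 t h Ht ltac:(lra)).
  assert (H8 : norm (conv (fun s =>
      minus (minus (g (s + h)) (g s)) (scal h (dg s))) t)
      <= K * (eps / (2 * K) * h)).
  { apply Hconv; [|exact Ht|].
    - apply continuous_on_minus; [apply continuous_on_minus; assumption|].
      apply continuous_on_scal; exact Hdg.
    - intros s Hs; apply H1; lra. }
  rewrite conv_minus, conv_minus, conv_scal in H8; try assumption; try lra;
    try (apply continuous_on_scal; exact Hdg);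
    try (apply continuous_on_minus; assumption).
  replace (K * (eps / (2 * K) * h)) with (eps / 2 * h) in H8 by (field; lra).
  match goal with |- norm (minus (minus (plus ?a ?b) ?d) (scal _ (plus ?e ?f))) <= _ =>
    replace (minus (minus (plus a b) d) (scal h (plus e f)))
      with (plus (minus a (scal h f)) (minus (minus b d) (scal h e))) by vec end.
  apply Rle_trans with (1 := norm_le_plus _ _ _ _ H2 H8); lra.
Qed.

End Convolution.

(** * The delayed series *)

Definition right_derivative_at {Y : CompleteNormedModule R_AbsRing}
    (f : R -> Y) (t : R) (l : Y) : Prop :=
  forall eps, 0 < eps -> exists delta, 0 < delta /\ forall h, 0 < h < delta ->
    norm (minus (minus (f (t + h)) (f t)) (scal h l)) <= eps * h.

(** [iter_conv T A1 n t] is the paper's [S_n(t + n tau, n tau)]; the shift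
    removes the delay from the recursion. *)
Fixpoint iter_conv {Y : CompleteNormedModule R_AbsRing} (T : R -> Y -> Y)
    (A1 : Y -> Y) (n : nat) (t : R) (x : Y) : Y :=
  match n with
  | O => T t x
  | S m => conv (T := T) (A1 := A1) (fun s => iter_conv T A1 m s x) t
  end.

(** The convention that the term of index -1 is zero gives the derivative of the terms one formula
    for all [n]. *)
Definition iter_conv_pred {Y : CompleteNormedModule R_AbsRing} (T : R -> Y -> Y)
    (A1 : Y -> Y) (n : nat) (t : R) (x : Y) : Y :=
  match n with O => zero | S m => iter_conv T A1 m t x end.

Definition causal {Y : CompleteNormedModule R_AbsRing} (V : R -> Y -> Y)
    (t : R) (x : Y) : Y :=
  if Rlt_dec t 0 then zero else V t x.

(** A partial sum of the series for the fundamental solution, equal to it for times below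
    [(N + 1) tau]. *)
Definition delay_sum {Y : CompleteNormedModule R_AbsRing} (tau : R)
    (T : R -> Y -> Y) (A1 : Y -> Y) (N : nat) (t : R) (x : Y) : Y :=
  sum_n (fun n => causal (iter_conv T A1 n) (t - INR n * tau) x) N.

Section DelaySum.

Context {Y : CompleteNormedModule R_AbsRing} {T : R -> Y -> Y} {A1 : Y -> Y}.
Hypothesis HT : strongly_continuous_semigroup T.
Hypothesis HA1 : is_linear A1.

Local Notation V := (iter_conv T A1).

Lemma iter_conv_unif_continuous n x : unif_continuous (fun t => V n t x).
Proof.
  induction n as [|n IH].
  - apply (semigroup_unif_continuous HT).
  - apply (conv_unif_continuous HT HA1), IH.
Qed.

Lemma iter_conv_continuous_on n x : continuous_on half_line (fun t => V n t x).
Proof. apply unif_continuous_continuous_on, iter_conv_unif_continuous. Qed.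

Lemma iter_conv_minus n t x y : 0 <= t ->
  V n t (minus x y) = minus (V n t x) (V n t y).
Proof.
  revert t; induction n as [|n IH]; intros t Ht; cbn [iter_conv].
  - apply (linear_sub (T t)), (sg_linear T HT), Ht.
  - rewrite <- (conv_minus HT HA1) by (try exact Ht; apply iter_conv_continuous_on).
    apply conv_ext; [exact Ht|]; intros s Hs; apply IH; lra.
Qed.

Lemma iter_conv_scal n t r x : 0 <= t -> V n t (scal r x) = scal r (V n t x).
Proof.
  revert t; induction n as [|n IH]; intros t Ht; cbn [iter_conv].
  - apply (linear_scale (T t)), (sg_linear T HT), Ht.
  - rewrite <- (conv_scal HT HA1) by (try exact Ht; apply iter_conv_continuous_on).
    apply conv_ext; [exact Ht|]; intros s Hs; apply IH; lra.
Qed.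

Lemma iter_conv_bounded n L : exists K, 0 < K /\
  forall t x, 0 <= t <= L -> norm (V n t x) <= K * norm x.
Proof.
  induction n as [|n [K [HK IH]]].
  - destruct (semigroup_bounded HT L) as [M [HM H]]; exists M; split; [lra | exact H].
  - destruct (conv_bounded HT HA1 L) as [C [HC H]].
    exists (C * K); split; [nra|]; intros t x Ht; rewrite Rmult_assoc.
    apply H; [apply iter_conv_continuous_on | exact Ht|].
    intros s Hs; apply IH; lra.
Qed.

(** For [n = 0], [T s] is applied to the difference quotient at 0; here [y] is the value of the
    generator at [x]. Each further term is a convolution, differentiated by
    [conv_right_derivative]. *)
Lemma iter_conv_right_derivative n x y :
  right_derivative_at (fun t => T t x) 0 y ->
  unif_right_derivative (fun t => V n t x)
    (fun t => plus (V n t y) (iter_conv_pred T A1 n t (A1 x))).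
Proof.
  intros Hgen; induction n as [|n IH]; cbn [iter_conv iter_conv_pred].
  - intros L eps Heps; destruct (semigroup_bounded HT L) as [M [HM HTM]].
    destruct (Hgen (eps / M)) as [d [Hd H]]; [apply Rdiv_lt_0_compat; lra|].
    exists d; split; [exact Hd|]; intros s h Hs Hh; specialize (H h Hh).
    rewrite Rplus_0_l, (sg_zero T HT) in H.
    assert (Hlin : is_linear (T s)) by (apply (sg_linear T HT); lra).
    rewrite (sg_add T HT) by lra.
    replace (minus (minus (T s (T h x)) (T s x)) (scal h (plus (T s y) zero)))
      with (T s (minus (minus (T h x) x) (scal h y)))
      by (rewrite !(linear_sub (T s) Hlin), (linear_scale (T s) Hlin); vec).
    apply Rle_trans with (1 := HTM s _ Hs).
    replace (eps * h) with (M * (eps / M * h)) by (field; lra).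
    apply Rmult_le_compat_l; lra.
  - assert (Hd : continuous_on half_line
      (fun t => plus (V n t y) (iter_conv_pred T A1 n t (A1 x)))).
    { apply continuous_on_ext with
        (fun t => minus (V n t y) (scal (-1) (iter_conv_pred T A1 n t (A1 x)))).
      - intros t _; vec.
      - apply continuous_on_minus; [apply iter_conv_continuous_on|].
        apply continuous_on_scal; destruct n as [|n]; cbn [iter_conv_pred].
        + intros t _; apply filterlim_const.
        + apply iter_conv_continuous_on. }
    pose proof (conv_right_derivative HT HA1 _ _
      (iter_conv_unif_continuous n x) Hd IH) as H.
    intros L eps Heps; destruct (H L eps Heps) as [d [Hd0 Hd1]].
    exists d; split; [exact Hd0|]; intros s h Hs Hh.
    replace (plus (conv (fun r => V n r y) s) (V n s (A1 x)))
      with (plus (conv (T := T) (A1 := A1)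
               (fun t => plus (V n t y) (iter_conv_pred T A1 n t (A1 x))) s)
             (T s (A1 (V n 0 x)))); [apply Hd1; assumption|].
    (* The boundary term is [T s (A1 x)] when [n] is 0, as [T 0] is the identity. For larger [n] it
       vanishes, because [V n] is a convolution and starts from zero. *)
    destruct n as [|n]; cbn [iter_conv iter_conv_pred].
    + rewrite (sg_zero T HT); f_equal; apply conv_ext; [lra|]; intros r _; vec.
    + rewrite (conv_plus HT HA1 (fun t => V (S n) t y) (fun t => V n t (A1 x)))
        by (try lra; apply iter_conv_continuous_on).
      rewrite conv_0, (linear_at_zero A1 HA1).
      rewrite (linear_at_zero (T s)) by (apply (sg_linear T HT); lra).
      cbn [iter_conv]; vec.
Qed.

Lemma causal_neg (W : R -> Y -> Y) t x : t < 0 -> causal W t x = zero.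
Proof. intros H; unfold causal; destruct (Rlt_dec t 0); [reflexivity | lra]. Qed.

Lemma causal_nonneg (W : R -> Y -> Y) t x : 0 <= t -> causal W t x = W t x.
Proof. intros H; unfold causal; destruct (Rlt_dec t 0); [lra | reflexivity]. Qed.

(** A short interval to the right of [t] lies entirely on one side of 0, so neither the jump nor the
    kinks at 0 affect right derivatives. *)
Lemma causal_right_derivative n x y t :
  right_derivative_at (fun t => T t x) 0 y ->
  right_derivative_at (fun s => causal (V n) s x) t
    (plus (causal (V n) t y) (causal (iter_conv_pred T A1 n) t (A1 x))).
Proof.
  intros Hgen eps Heps; destruct (Rlt_le_dec t 0) as [Ht|Ht].
  - exists (- t); split; [lra|]; intros h Hh.
    rewrite !causal_neg by lra.
    match goal with |- norm ?v <= _ => replace v with (zero : Y) by vec end.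
    rewrite norm_of_zero; nra.
  - destruct (iter_conv_right_derivative n x y Hgen t eps Heps) as [d [Hd H]].
    exists d; split; [exact Hd|]; intros h Hh.
    rewrite !causal_nonneg by lra; apply H; lra.
Qed.

Lemma right_derivative_at_plus (f g : R -> Y) t k l :
  right_derivative_at f t k -> right_derivative_at g t l ->
  right_derivative_at (fun s => plus (f s) (g s)) t (plus k l).
Proof.
  intros Hf Hg eps Heps.
  destruct (Hf (eps / 2)) as [d1 [Hd1 H1]]; [lra|].
  destruct (Hg (eps / 2)) as [d2 [Hd2 H2]]; [lra|].
  exists (Rmin d1 d2); split; [apply Rmin_pos; lra|]; intros h Hh.
  pose proof (Rmin_l d1 d2); pose proof (Rmin_r d1 d2).
  match goal with |- norm ?v <= _ => replace v with
    (plus (minus (minus (f (t + h)) (f t)) (scal h k))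
          (minus (minus (g (t + h)) (g t)) (scal h l))) by vec end.
  replace (eps * h) with (eps / 2 * h + eps / 2 * h) by field.
  apply norm_le_plus; [apply H1 | apply H2]; lra.
Qed.

Lemma right_derivative_at_shift (f : R -> Y) t c l :
  right_derivative_at f (t - c) l ->
  right_derivative_at (fun s => f (s - c)) t l.
Proof.
  intros H eps Heps; destruct (H eps Heps) as [d [Hd Hd']].
  exists d; split; [exact Hd|]; intros h Hh.
  replace (t + h - c) with (t - c + h) by ring; apply Hd'; exact Hh.
Qed.

Variable tau : R.
Hypothesis Htau : 0 < tau.

Local Notation DS := (delay_sum tau T A1).

Lemma delay_sum_S N t x :
  DS (S N) t x = plus (DS N t x) (causal (V (S N)) (t - INR (S N) * tau) x).
Proof. exact (sum_Sn _ N). Qed.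

Lemma delay_sum_0 t x : DS 0 t x = causal (V 0) t x.
Proof.
  unfold delay_sum; rewrite sum_O; cbn [INR]; f_equal; ring.
Qed.

Lemma delay_sum_neg N t x : t < 0 -> DS N t x = zero.
Proof.
  intros Ht; induction N as [|N IH].
  - rewrite delay_sum_0; apply causal_neg, Ht.
  - rewrite delay_sum_S, IH, causal_neg; [vec|].
    pose proof (pos_INR (S N)); nra.
Qed.

Lemma delay_sum_at_0 N x : DS N 0 x = x.
Proof.
  induction N as [|N IH].
  - rewrite delay_sum_0, causal_nonneg by lra; apply (sg_zero T HT).
  - rewrite delay_sum_S, IH, causal_neg; [vec|].
    rewrite S_INR; pose proof (pos_INR N); nra.
Qed.

Lemma causal_minus n t x y :
  causal (V n) t (minus x y) = minus (causal (V n) t x) (causal (V n) t y).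
Proof.
  unfold causal; destruct (Rlt_dec t 0); [vec | apply iter_conv_minus; lra].
Qed.

Lemma causal_scal n t r x : causal (V n) t (scal r x) = scal r (causal (V n) t x).
Proof.
  unfold causal; destruct (Rlt_dec t 0); [vec | apply iter_conv_scal; lra].
Qed.

Lemma delay_sum_minus N t x y : DS N t (minus x y) = minus (DS N t x) (DS N t y).
Proof.
  induction N as [|N IH].
  - rewrite !delay_sum_0; apply causal_minus.
  - rewrite !delay_sum_S, IH, causal_minus; vec.
Qed.

Lemma delay_sum_scal N t r x : DS N t (scal r x) = scal r (DS N t x).
Proof.
  induction N as [|N IH].
  - rewrite !delay_sum_0; apply causal_scal.
  - rewrite !delay_sum_S, IH, causal_scal; vec.
Qed.

Lemma causal_bounded n L : exists K, 0 < K /\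
  forall t x, t <= L -> norm (causal (V n) t x) <= K * norm x.
Proof.
  destruct (iter_conv_bounded n L) as [K [HK H]]; exists K; split; [exact HK|].
  intros t x Ht; unfold causal; destruct (Rlt_dec t 0); [|apply H; lra].
  rewrite norm_of_zero; pose proof (norm_ge_0 x); nra.
Qed.

Lemma delay_sum_bounded N L : exists K, 0 < K /\
  forall t x, t <= L -> norm (DS N t x) <= K * norm x.
Proof.
  induction N as [|N [K [HK IH]]].
  - destruct (causal_bounded 0 L) as [K [HK H]]; exists K; split; [exact HK|].
    intros t x Ht; rewrite delay_sum_0; apply H, Ht.
  - destruct (causal_bounded (S N) L) as [K' [HK' H]].
    exists (K + K'); split; [lra|]; intros t x Ht; rewrite delay_sum_S.
    rewrite Rmult_plus_distr_r; apply norm_le_plus; [apply IH, Ht | apply H].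
    pose proof (pos_INR (S N)); nra.
Qed.

Lemma iter_conv_clamped_continuous_on n c x (D : R -> Prop) :
  continuous_on D (fun t => V n (Rmax 0 (t - c)) x).
Proof.
  apply (continuous_on_comp_contraction half_line D (fun t => Rmax 0 (t - c))
    (fun t => V n t x)).
  - intros r s; unfold Rmax, Rabs; repeat destruct Rle_dec;
      repeat destruct Rcase_abs; lra.
  - intros s _; apply Rmax_l.
  - apply iter_conv_continuous_on.
Qed.

(** For [n >= 1] the term starts from [0], so extending it by zero to
    negative times creates no jump. *)
Lemma delay_sum_continuous_on N x : continuous_on half_line (fun t => DS N t x).
Proof.
  induction N as [|N IH].
  - apply continuous_on_ext with (fun t => V 0 (Rmax 0 (t - 0)) x);
      [|apply iter_conv_clamped_continuous_on].
    unfold half_line; intros t Ht.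
    rewrite delay_sum_0, causal_nonneg, Rmax_right by lra; f_equal; ring.
  - apply continuous_on_ext with (fun t => minus (DS N t x)
      (scal (-1) (V (S N) (Rmax 0 (t - INR (S N) * tau)) x))).
    + intros t _; rewrite delay_sum_S.
      destruct (Rlt_le_dec (t - INR (S N) * tau) 0) as [H|H].
      * rewrite causal_neg, Rmax_left by lra; cbn [iter_conv].
        rewrite conv_0; vec.
      * rewrite causal_nonneg, Rmax_right by lra; vec.
    + apply continuous_on_minus; [exact IH|].
      apply continuous_on_scal, iter_conv_clamped_continuous_on.
Qed.

(** Lowering the index by one delays the time by [tau]. This produces the delayed term in the
    derivative of the sum. *)
Lemma delay_sum_pred N t x :
  sum_n (fun n => causal (iter_conv_pred T A1 n) (t - INR n * tau) x) (S N)
  = DS N (t - tau) x.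
Proof.
  induction N as [|N IH].
  - rewrite sum_Sn, sum_O, delay_sum_0; cbn [INR].
    replace (t - 1 * tau) with (t - tau) by ring.
    unfold causal, iter_conv_pred; destruct (Rlt_dec (t - 0 * tau) 0);
      apply plus_zero_l.
  - rewrite sum_Sn, IH, delay_sum_S.
    replace (t - INR (S (S N)) * tau) with (t - tau - INR (S N) * tau)
      by (rewrite (S_INR (S N)); ring).
    reflexivity.
Qed.

Lemma delay_sum_right_derivative N x y t :
  right_derivative_at (fun s => T s x) 0 y -> t < INR (S N) * tau ->
  right_derivative_at (fun s => DS N s x) t
    (plus (DS N t y) (DS N (t - tau) (A1 x))).
Proof.
  intros Hgen Ht.
  (* The two sums differ by the term of index [N + 1], which is zero because [t < (N + 1) tau]. *)
  assert (E : DS N (t - tau) (A1 x) =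
    sum_n (fun n => causal (iter_conv_pred T A1 n) (t - INR n * tau) (A1 x)) N).
  { transitivity (plus (sum_n (fun n => causal (iter_conv_pred T A1 n)
      (t - INR n * tau) (A1 x)) N)
      (causal (iter_conv_pred T A1 (S N)) (t - INR (S N) * tau) (A1 x))).
    - rewrite <- delay_sum_pred; exact (sum_Sn _ N).
    - rewrite causal_neg by lra; vec. }
  (* The termwise formula holds at every [t]; the bound is cleared because it need not hold for
     smaller [N] in the induction. *)
  rewrite E; clear E Ht; induction N as [|N IH].
  - rewrite sum_O, delay_sum_0; cbn [INR].
    replace (t - 0 * tau) with t by ring.
    intros eps Heps; destruct (causal_right_derivative 0 x y t Hgen eps Heps)
      as [d [Hd H]]; exists d; split; [exact Hd|]; intros h Hh.
    rewrite !delay_sum_0; apply H; exact Hh.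
  - pose proof (right_derivative_at_shift _ t (INR (S N) * tau) _
      (causal_right_derivative (S N) x y (t - INR (S N) * tau) Hgen)) as H.
    pose proof (right_derivative_at_plus _ _ _ _ _ IH H) as H'.
    intros eps Heps; destruct (H' eps Heps) as [d [Hd Hd']].
    exists d; split; [exact Hd|]; intros h Hh; specialize (Hd' h Hh).
    rewrite sum_Sn, !delay_sum_S.
    match goal with |- norm ?v <= _ => match type of Hd' with norm ?w <= _ =>
      replace v with w by vec end end.
    exact Hd'.
Qed.

End DelaySum.

(** * The representation formula in a real Banach space *)

Definition left_derivative_at {Y : CompleteNormedModule R_AbsRing}
    (f : R -> Y) (t : R) (l : Y) : Prop :=
  forall eps, 0 < eps -> exists delta, 0 < delta /\ forall h, 0 < h < delta ->
    norm (plus (minus (f (t - h)) (f t)) (scal h l)) <= eps * h.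

Section Representation.

Context {Y : CompleteNormedModule R_AbsRing} {T : R -> Y -> Y} {A1 : Y -> Y}.
Hypothesis HT : strongly_continuous_semigroup T.
Hypothesis HA1 : is_linear A1.
Variables (tau t : R) (N : nat) (u : R -> Y).
Hypothesis Htau : 0 < tau.
Hypothesis Ht : 0 <= t.
Hypothesis HtN : t < INR (S N) * tau.
Hypothesis Hu : continuous_on (fun s => - tau <= s) u.

Local Notation DS := (delay_sum tau T A1 N).

Let w (q : R) : Y := DS q (A1 (u (t - tau - q))).

Lemma delay_sum_apply_continuous_on (g : R -> Y) :
  continuous_on (fun q => 0 <= q <= t) g ->
  continuous_on (fun q => 0 <= q <= t) (fun q => DS q (g q)).
Proof.
  intros Hg; destruct (delay_sum_bounded HT HA1 tau Htau N t) as [K [HK HDS]].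
  apply (continuous_on_family_apply _ DS g K).
  - intros q _ x y; apply (delay_sum_minus HT HA1).
  - intros q Hq x; apply HDS; lra.
  - exact HK.
  - intros x; apply continuous_on_subset with half_line;
      [unfold half_line; intros; lra|].
    apply (delay_sum_continuous_on HT HA1).
  - exact Hg.
Qed.

Lemma delayed_integrand_continuous_on : continuous_on (fun q => 0 <= q <= t) w.
Proof.
  apply delay_sum_apply_continuous_on, continuous_on_linear; [exact HA1|].
  apply (continuous_on_reflect (fun s => - tau <= s)); [|exact Hu].
  intros s Hs; lra.
Qed.

Lemma delayed_integrand_neg q : q < 0 -> w q = zero.
Proof. intros Hq; apply delay_sum_neg; assumption. Qed.

Lemma delayed_integrand_bounded : exists C, 0 < C /\
  forall q, q <= t -> norm (w q) <= C.
Proof.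
  destruct (continuous_on_bounded 0 t w Ht delayed_integrand_continuous_on)
    as [C [HC H]].
  exists C; split; [exact HC|]; intros q Hq; destruct (Rlt_le_dec q 0) as [Hn|Hp].
  - rewrite (delayed_integrand_neg q Hn), norm_of_zero; lra.
  - apply H; lra.
Qed.

(** [w] is zero before 0 and may jump there, so integrability is obtained on each side of 0 and
    joined. *)
Lemma delayed_integrand_ex_RInt a b : - tau <= a <= b -> b <= t -> ex_RInt w a b.
Proof.
  intros Hab Hb; apply (ex_RInt_Chasles_2 w (- tau)); [exact Hab|].
  apply (ex_RInt_Chasles_1 w _ _ t); [lra|].
  apply ex_RInt_Chasles with 0.
  - apply ex_RInt_ext with (fun _ => zero); [|apply ex_RInt_const].
    rewrite Rmin_left, Rmax_right by lra; intros q Hq.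
    symmetry; apply delayed_integrand_neg; lra.
  - apply ex_RInt_continuous_on; [exact Ht | exact delayed_integrand_continuous_on].
Qed.

Lemma delayed_integrand_right_continuous r eps : r < t -> 0 < eps ->
  exists delta, 0 < delta /\
    forall h, 0 <= h < delta -> norm (minus (w (r + h)) (w r)) <= eps.
Proof.
  intros Hrt Heps; destruct (Rlt_le_dec r 0) as [Hr|Hr].
  - exists (- r); split; [lra|]; intros h Hh.
    rewrite !delayed_integrand_neg, norm_minus_diag by lra; lra.
  - destruct (proj1 (continuous_on_eps_delta _ _)
      delayed_integrand_continuous_on r ltac:(lra) eps Heps) as [d [Hd H]].
    exists (Rmin d (t - r)); split; [apply Rmin_pos; lra|]; intros h Hh.
    pose proof (Rmin_l d (t - r)); pose proof (Rmin_r d (t - r)).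
    left; apply H; [lra|]; replace (r + h - r) with h by ring.
    rewrite Rabs_pos_eq; lra.
Qed.

(** The base point is [- tau] because [K] is evaluated at [r - tau] with [r] in [[0, t]]. *)
Let K (r : R) : Y := RInt w (- tau) r.

Lemma primitive_increment a b : - tau <= a <= b -> b <= t ->
  minus (K b) (K a) = RInt w a b.
Proof.
  intros Hab Hb; unfold K.
  rewrite <- (RInt_Chasles w (- tau) a b)
    by (apply delayed_integrand_ex_RInt; lra).
  vec.
Qed.

Lemma primitive_right_derivative r : - tau <= r < t ->
  right_derivative_at K r (w r).
Proof.
  intros Hr eps Heps.
  destruct (delayed_integrand_right_continuous r eps) as [d [Hd H]]; try lra.
  exists (Rmin d (t - r)); split; [apply Rmin_pos; lra|]; intros h Hh.
  pose proof (Rmin_l d (t - r)); pose proof (Rmin_r d (t - r)).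
  rewrite primitive_increment by lra.
  rewrite (Rmult_comm eps); replace h with (r + h - r) at 2 3 by ring.
  apply norm_RInt_minus_scal; [lra | apply delayed_integrand_ex_RInt; lra|].
  intros q Hq; specialize (H (q - r) ltac:(lra)).
  replace (r + (q - r)) with q in H by ring; exact H.
Qed.

(** Supplies the left continuity required by [right_derivative_zero_constant], also at the possible
    jump of [w]. *)
Lemma primitive_lipschitz : exists C, 0 < C /\ forall a b,
  - tau <= a <= b -> b <= t -> norm (minus (K a) (K b)) <= (b - a) * C.
Proof.
  destruct delayed_integrand_bounded as [C [HC H]]; exists C; split; [exact HC|].
  intros a b Hab Hb; rewrite norm_minus_sym, primitive_increment by assumption.
  apply norm_RInt_le_bound; [lra | apply delayed_integrand_ex_RInt; lra|].
  intros q Hq; apply H; lra.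
Qed.

Hypothesis Hsol : forall s, 0 < s <= t -> exists a,
  right_derivative_at (fun r => T r (u s)) 0 a /\
  left_derivative_at u s (plus a (A1 (u (s - tau)))).

(** A product rule: increasing [q] moves [u (t - q)] backwards, so the left derivative of [u]
    enters, and [r < t] keeps its argument positive. *)
Lemma duality_right_derivative r : 0 <= r < t ->
  right_derivative_at (fun q => DS q (u (t - q))) r
    (minus (w (r - tau)) (w r)).
Proof.
  intros Hr eps Heps.
  destruct (Hsol (t - r)) as [a [Hgen Hl]]; [lra|].
  set (v := u (t - r)) in *.
  set (l := plus a (A1 (u (t - r - tau)))) in *.
  destruct (delay_sum_bounded HT HA1 tau Htau N t) as [C [HC HDS]].
  destruct (Hl (eps / (3 * C))) as [d1 [Hd1 H1]];
    [apply Rdiv_lt_0_compat; lra|].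
  destruct (delay_sum_right_derivative HT HA1 tau N v a r Hgen
    ltac:(lra) (eps / 3)) as [d2 [Hd2 H2]]; [lra|].
  destruct (proj1 (continuous_on_eps_delta _ _)
    (delay_sum_continuous_on HT HA1 tau N l) r (proj1 Hr) (eps / 3))
    as [d3 [Hd3 H3]]; [lra|].
  exists (Rmin (Rmin d1 d2) (Rmin d3 (t - r))).
  split; [repeat apply Rmin_pos; lra|]; intros h Hh.
  pose proof (Rmin_l (Rmin d1 d2) (Rmin d3 (t - r))).
  pose proof (Rmin_r (Rmin d1 d2) (Rmin d3 (t - r))).
  pose proof (Rmin_l d1 d2); pose proof (Rmin_r d1 d2).
  pose proof (Rmin_l d3 (t - r)); pose proof (Rmin_r d3 (t - r)).
  specialize (H1 h ltac:(lra)); specialize (H2 h ltac:(lra)).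
  specialize (H3 (r + h) ltac:(unfold half_line; lra)).
  replace (r + h - r) with h in H3 by ring; rewrite Rabs_pos_eq in H3 by lra.
  specialize (H3 ltac:(lra)).
  pose proof (HDS (r + h) (minus (minus (u (t - r - h)) v) (scal (- h) l))
    ltac:(lra)) as G1.
  (* Since [l] is [a] plus the delayed term, the contributions of [a] cancel and [w r] is what
     remains. *)
  assert (E : minus (w (r - tau)) (w r)
      = minus (DS (r - tau) (A1 v)) (minus (DS r l) (DS r a))).
  { unfold w, v, l; rewrite <- (delay_sum_minus HT HA1).
    replace (t - tau - (r - tau)) with (t - r) by ring.
    replace (t - tau - r) with (t - r - tau) by ring.
    do 2 f_equal; vec. }
  rewrite E; replace (t - (r + h)) with (t - r - h) by ring; fold v.
  rewrite !(delay_sum_minus HT HA1), (delay_sum_scal HT HA1) in G1.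
  replace (minus (minus (u (t - r - h)) v) (scal (- h) l))
    with (plus (minus (u (t - r - h)) v) (scal h l)) in G1 by vec.
  assert (G2 : C * norm (plus (minus (u (t - r - h)) v) (scal h l))
      <= eps / 3 * h).
  { replace (eps / 3 * h) with (C * (eps / (3 * C) * h)) by (field; lra).
    apply Rmult_le_compat_l; [lra | exact H1]. }
  pose proof (norm_le_scal h _ _ (Rlt_le _ _ H3)) as G3.
  rewrite Rabs_pos_eq in G3 by lra.
  (* The three errors are the remainder of [u] under the bounded [DS (r + h)], the change of [DS] at
     the fixed vector [l], and the remainder of [DS] at [v]. *)
  pose proof (norm_le_plus _ _ _ _
    (norm_le_minus _ _ _ _ (Rle_trans _ _ _ G1 G2) G3) H2) as G4.
  replace (eps * h) with (eps / 3 * h + h * (eps / 3) + eps / 3 * h) by field.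
  refine (Rle_trans _ _ _ (Req_le _ _ _) G4); f_equal; vec.
Qed.

Lemma delay_representation :
  ex_RInt w (t - tau) t /\
  u t = plus (DS t (u 0)) (RInt w (t - tau) t).
Proof.
  split; [apply delayed_integrand_ex_RInt; lra|].
  set (F := fun r => plus (DS r (u (t - r))) (minus (K r) (K (r - tau)))).
  assert (HF : F t = F 0).
  { apply right_derivative_zero_constant; [exact Ht| |].
    - intros r Hr eps Heps.
      destruct (duality_right_derivative r Hr (eps / 3)) as [d1 [Hd1 H1]]; [lra|].
      destruct (primitive_right_derivative r ltac:(lra) (eps / 3))
        as [d2 [Hd2 H2]]; [lra|].
      destruct (primitive_right_derivative (r - tau) ltac:(lra) (eps / 3))
        as [d3 [Hd3 H3]]; [lra|].
      exists (Rmin d1 (Rmin d2 d3)); split; [repeat apply Rmin_pos; lra|].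
      intros h Hh.
      pose proof (Rmin_l d1 (Rmin d2 d3)); pose proof (Rmin_r d1 (Rmin d2 d3)).
      pose proof (Rmin_l d2 d3); pose proof (Rmin_r d2 d3).
      specialize (H1 h ltac:(lra)); specialize (H2 h ltac:(lra)).
      specialize (H3 h ltac:(lra)).
      replace (r - tau + h) with (r + h - tau) in H3 by ring.
      pose proof (norm_le_minus _ _ _ _ (norm_le_plus _ _ _ _ H1 H2) H3) as G1.
      replace (eps * h) with (eps / 3 * h + eps / 3 * h + eps / 3 * h) by field.
      refine (Rle_trans _ _ _ (Req_le _ _ _) G1); f_equal; unfold F; vec.
    - intros r Hr eps Heps.
      assert (Hc : continuous_on (fun q => 0 <= q <= t) (fun q => DS q (u (t - q)))).
      { apply (delay_sum_apply_continuous_on (fun q => u (t - q))).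
        apply (continuous_on_reflect (fun s => - tau <= s)); [|exact Hu].
        intros s Hs; lra. }
      destruct (proj1 (continuous_on_eps_delta _ _) Hc r ltac:(lra) (eps / 2))
        as [d1 [Hd1 H1]]; [lra|].
      destruct primitive_lipschitz as [C [HC HK]].
      exists (Rmin (Rmin d1 r) (eps / (4 * C))).
      split; [repeat apply Rmin_pos; try lra; apply Rdiv_lt_0_compat; lra|].
      intros h Hh.
      pose proof (Rmin_l (Rmin d1 r) (eps / (4 * C))).
      pose proof (Rmin_r (Rmin d1 r) (eps / (4 * C))).
      pose proof (Rmin_l d1 r); pose proof (Rmin_r d1 r).
      specialize (H1 (r - h) ltac:(lra)).
      replace (r - h - r) with (- h) in H1 by ring.
      rewrite Rabs_Ropp, Rabs_pos_eq in H1 by lra; specialize (H1 ltac:(lra)).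
      pose proof (HK (r - h) r ltac:(lra) ltac:(lra)) as G2.
      pose proof (HK (r - h - tau) (r - tau) ltac:(lra) ltac:(lra)) as G3.
      replace (r - (r - h)) with h in G2 by ring.
      replace (r - tau - (r - h - tau)) with h in G3 by ring.
      pose proof (norm_le_minus _ _ _ _
        (norm_le_plus _ _ _ _ (Rlt_le _ _ H1) G2) G3) as G1.
      assert (h * C <= eps / 4).
      { replace (eps / 4) with (eps / (4 * C) * C) by (field; lra).
        apply Rmult_le_compat_r; lra. }
      apply Rle_trans with (eps / 2 + h * C + h * C); [|lra].
      refine (Rle_trans _ _ _ (Req_le _ _ _) G1); f_equal; unfold F; vec. }
  (* At [t] the difference of primitives is the integral in the claim; at 0 it is an integral over
     [[- tau, 0]], where [w] vanishes except possibly at the end point 0. *)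
  unfold F in HF; rewrite primitive_increment in HF by lra.
  rewrite primitive_increment in HF by lra.
  replace (t - t) with 0 in HF by ring; rewrite HF.
  rewrite (delay_sum_at_0 HT tau Htau), Rminus_0_r.
  assert (E : RInt w (0 - tau) 0 = zero).
  { transitivity (RInt (fun _ => (zero : Y)) (0 - tau) 0).
    - apply RInt_ext; rewrite Rmin_left, Rmax_right by lra; intros q Hq.
      apply delayed_integrand_neg; lra.
    - rewrite RInt_const; vec. }
  rewrite E; vec.
Qed.

End Representation.

(** * Complex scalars *)

Section FundamentalSolution.

Context {X : CompleteNormedModule C_AbsRing} {T : R -> X -> X} {A1 : X -> X}.

Lemma is_linear_realify (F : X -> X) :
  is_linear F -> is_linear (F : realify X -> realify X).
Proof.
  intros HF; split.
  - exact (linear_plus F HF).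
  - intros r x; exact (linear_scal F HF (RtoC r) x).
  - exact (linear_norm F HF).
Qed.

Lemma at_right_0_eps_delta (f : R -> X) (l : X) :
  filterlim f (at_right 0) (locally l) ->
  forall eps, 0 < eps -> exists delta, 0 < delta /\ forall h, 0 < h < delta ->
    norm (minus (f h : realify X) l) <= eps.
Proof.
  intros Hf eps Heps.
  destruct (proj1 (filterlim_locally_ball_norm f l) Hf (mkposreal eps Heps))
    as [d Hd].
  exists d; split; [apply cond_pos|]; intros h Hh; left; apply (Hd h); [|lra].
  change (Rabs (h - 0) < d); rewrite Rabs_pos_eq; lra.
Qed.

Lemma C0_semigroup_realify : C0_semigroup T ->
  strongly_continuous_semigroup (T : R -> realify X -> realify X).
Proof.
  intros HT; split.
  - intros t Ht; apply is_linear_realify, (C0_bounded T HT t Ht).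
  - exact (C0_zero T HT).
  - exact (C0_add T HT).
  - intros x eps Heps.
    destruct (at_right_0_eps_delta _ x (C0_strong T HT x) eps Heps) as [d [Hd H]].
    exists d; split; [exact Hd|]; intros h Hh.
    destruct (Req_dec h 0) as [-> | Hne]; [|apply H; lra].
    rewrite (C0_zero T HT).
    rewrite (norm_minus_diag (x : realify X)); lra.
Qed.

Lemma generator_right_derivative (x y : X) : C0_semigroup T ->
  is_generator_at T x y ->
  right_derivative_at (fun t => T t x : realify X) 0 y.
Proof.
  intros HT Hgen eps Heps.
  destruct (at_right_0_eps_delta _ _ Hgen eps Heps) as [d [Hd H]].
  exists d; split; [exact Hd|]; intros h Hh.
  rewrite Rplus_0_l, (C0_zero T HT); specialize (H h Hh).
  exact (norm_minus_scal_of_quotient (Y := realify X) _ _ _ _ (proj1 Hh) H).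
Qed.

(** Negative increments are used; taking [Rmin d s] keeps [s - h] in the half line on which the
    derivative is defined. *)
Lemma left_derivative_of_is_derive_half (u : R -> X) (s : R) (l : X) : 0 < s ->
  is_derive_half u s l -> left_derivative_at (u : R -> realify X) s l.
Proof.
  intros Hs [_ Hdom] eps Heps.
  assert (Hlim : is_filter_lim (within (fun r => 0 <= r) (locally s)) s).
  { intros P HP; apply filter_imp with (2 := HP); auto. }
  destruct (Hdom s Hlim (mkposreal eps Heps)) as [d Hd].
  exists (Rmin d s); split; [apply Rmin_pos; [apply cond_pos | exact Hs]|].
  intros h Hh; pose proof (Rmin_l d s); pose proof (Rmin_r d s).
  assert (Hball : ball s d (s - h)).
  { change (Rabs (s - h - s) < d); replace (s - h - s) with (- h) by ring.
    rewrite Rabs_Ropp, Rabs_pos_eq; lra. }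
  specialize (Hd (s - h) Hball ltac:(lra)).
  change (norm (minus (minus (u (s - h) : realify X) (u s))
    (@scal R_Ring (realify X) (s - h - s) l)) <= eps * Rabs (s - h - s)) in Hd.
  replace (s - h - s) with (- h) in Hd by ring.
  rewrite Rabs_Ropp, Rabs_pos_eq in Hd by lra.
  rewrite (minus_scal_neg (Y := realify X)) in Hd; exact Hd.
Qed.

Hypothesis HT : C0_semigroup T.
Hypothesis HA1 : is_linear A1.

(** Substituting [s - c] with [c = (n + 1) tau] moves the lower limit to 0, and
    [s - tau = n tau + (s - c)] matches the induction hypothesis. *)
Lemma fund_term_iter_conv (tau : R) n t x : 0 <= t ->
  fund_term tau T A1 n (INR n * tau + t) x =
  iter_conv (Y := realify X) T A1 n t x.
Proof.
  revert t; induction n as [|n IH]; intros t Ht; cbn [fund_term iter_conv].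
  - f_equal; cbn; ring.
  - set (c := INR (S n) * tau).
    set (g := fun s => T (t - s) (A1 (iter_conv (Y := realify X) T A1 n s x))
      : realify X).
    assert (Hg : ex_RInt g 0 t).
    { apply (kernel_ex_RInt (C0_semigroup_realify HT) (is_linear_realify A1 HA1)
        (fun s => iter_conv (Y := realify X) T A1 n s x)); try lra.
      apply (iter_conv_continuous_on (C0_semigroup_realify HT)
        (is_linear_realify A1 HA1)). }
    pose proof (RInt_comp_lin g 1 (- c) c (c + t)) as E.
    replace (1 * c + - c) with 0 in E by ring.
    replace (1 * (c + t) + - c) with t in E by ring.
    refine (eq_trans _ (E Hg)).
    apply (RInt_ext (V := realify X)); rewrite Rmin_left, Rmax_right by lra.
    intros s Hs; unfold g.
    replace (s - tau) with (INR n * tau + (s - c))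
      by (unfold c; rewrite S_INR; ring).
    rewrite IH by lra.
    replace (1 * s + - c) with (s - c) by ring.
    replace (t - (s - c)) with (c + t - s) by ring.
    symmetry; exact (scal_one (V := realify X) _).
Qed.

(** Terms with [n tau > t] are zero, so the partial sums are constant from [N] on, and [iota]
    returns that constant. *)
Lemma fund_sol_delay_sum (tau : R) N t x :
  0 < tau -> t < INR (S N) * tau ->
  fund_sol tau T A1 t x = delay_sum (Y := realify X) tau T A1 N t x.
Proof.
  intros Htau HtN; unfold fund_sol; destruct (Rlt_dec t 0) as [Hneg|Hpos].
  { symmetry; apply (delay_sum_neg (Y := realify X)); assumption. }
  set (a := fun n : nat => if Rle_dec (INR n * tau) t
    then fund_term tau T A1 n t x else zero).
  assert (Ha : forall n, a n =
    causal (iter_conv (Y := realify X) T A1 n) (t - INR n * tau) x).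
  { intros n; unfold a, causal.
    destruct (Rle_dec (INR n * tau) t), (Rlt_dec (t - INR n * tau) 0);
      try lra; [|reflexivity].
    rewrite <- (fund_term_iter_conv tau) by lra; f_equal; ring. }
  assert (Hsum : forall k, sum_n a (N + k) = sum_n a N).
  { induction k as [|k IH]; [rewrite Nat.add_0_r; reflexivity|].
    rewrite Nat.add_succ_r, sum_Sn, IH, Ha.
    rewrite causal_neg; [apply plus_zero_r|].
    rewrite S_INR, plus_INR; rewrite S_INR in HtN.
    pose proof (pos_INR k); nra. }
  transitivity (sum_n a N).
  - apply (iota_filterlim_locally (F := eventually) (sum_n a)).
    apply filterlim_ext_loc with (fun _ => sum_n a N); [|apply filterlim_const].
    exists N; intros m Hm; rewrite <- (Hsum (m - N)%nat); f_equal; lia.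
  - unfold delay_sum; transitivity (sum_n (fun n =>
      causal (iter_conv (Y := realify X) T A1 n) (t - INR n * tau) x : X) N);
      [apply sum_n_ext; exact Ha | reflexivity].
Qed.

End FundamentalSolution.

Theorem theorem12 :
  forall (X : CompleteNormedModule C_AbsRing) (tau : R) (T : R -> X -> X)
    (D : X -> Prop) (A0 A1 : X -> X) (phi u0 : R -> X),
  0 < tau ->
  C0_semigroup T ->
  is_generator T D A0 ->
  is_linear A1 ->
  continuous_on (fun s => - tau <= s <= 0) phi ->
  D (phi 0) ->
  classical_solution tau D A0 A1 phi u0 ->
  (forall t, 0 <= t -> D (u0 t)) /\
  (forall t, 0 <= t ->
     @ex_RInt (realify X)
       (fun s => fund_sol tau T A1 (t - tau - s) (A1 (phi s))) (- tau) 0 /\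
     u0 t = plus (fund_sol tau T A1 t (phi 0))
              (@RInt (realify X)
                 (fun s => fund_sol tau T A1 (t - tau - s) (A1 (phi s)))
                 (- tau) 0)).
Proof.
  intros X tau T D A0 A1 phi u0 Htau HT Hgen HA1 _ _ Hsol.
  split; [exact (sol_dom _ _ _ _ _ _ Hsol)|]; intros t Ht.
  (* One truncation index serves the whole formula: for [s] in [[- tau, 0]] the time [t - tau - s]
     is at most [t]. *)
  destruct (INR_unbounded (t / tau)) as [N HN].
  assert (HtN : t < INR (S N) * tau).
  { rewrite S_INR; replace t with (t / tau * tau) at 1 by (field; lra).
    apply Rmult_lt_compat_r; lra. }
  assert (Hleft : forall s, 0 < s <= t -> exists a : realify X,
    right_derivative_at (fun r => T r (u0 s) : realify X) 0 a /\
    left_derivative_at (u0 : R -> realify X) s (plus a (A1 (u0 (s - tau))))).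
  { intros s Hs; exists (A0 (u0 s)); split.
    - apply generator_right_derivative; [exact HT|].
      apply (proj2 Hgen), (sol_dom _ _ _ _ _ _ Hsol); lra.
    - apply (left_derivative_of_is_derive_half u0 s
        (plus (A0 (u0 s)) (A1 (u0 (s - tau))))); [lra|].
      apply (sol_eq _ _ _ _ _ _ Hsol); lra. }
  destruct (delay_representation (C0_semigroup_realify HT)
    (is_linear_realify A1 HA1) tau t N (u0 : R -> realify X) Htau Ht HtN
    (sol_cont _ _ _ _ _ _ Hsol) Hleft) as [Hex Hrep].
  set (w := fun q => delay_sum (Y := realify X) tau T A1 N q
    (A1 (u0 (t - tau - q)))) in *.
  (* The substitution [q = t - tau - s] turns the integral of [w] into the one claimed. Stated with
     [is_RInt], it yields both existence and value. *)
  assert (HI : is_RInt (V := realify X)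
    (fun s => fund_sol tau T A1 (t - tau - s) (A1 (phi s))) (- tau) 0
    (RInt w (t - tau) t)).
  { apply (is_RInt_ext (V := realify X)) with (fun s => w (t - tau - s)).
    - rewrite Rmin_left, Rmax_right by lra; intros s Hs; unfold w.
      rewrite (fund_sol_delay_sum HT HA1 tau N) by lra.
      replace (t - tau - (t - tau - s)) with s by ring.
      rewrite (sol_init _ _ _ _ _ _ Hsol) by lra; reflexivity.
    - apply (is_RInt_reflect (Y := realify X)).
      replace (t - tau - - tau) with t by ring; rewrite Rminus_0_r.
      exact (RInt_correct _ _ _ Hex). }
  split; [exists (RInt w (t - tau) t); exact HI|].
  rewrite (is_RInt_unique _ _ _ _ HI).
  rewrite (fund_sol_delay_sum HT HA1 tau N) by assumption.
  rewrite <- (sol_init _ _ _ _ _ _ Hsol 0) by lra.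
  exact Hrep.
Qed.
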